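(* For all $0<p,q\le\infty$ there exist constants $c_{p,q},C_{p,q}\in(0,\infty)$ depending only on $p$ and $q$ such that for all $n,N\in\mathbb{N}$, \[ c_{p,q}\,\Phi_{p,q}(n,N)\;\le\; e_n\big(\mathcal{S}_p^N\hookrightarrow \mathcal{S}_q^N\big)\;\le\; C_{p,q}\,\Phi_{p,q}(n,N), \] where (with $1/\infty=0$) \[ \Phi_{p,q}(n,N)= \begin{cases} 2^{-\frac{n}{N^2}}\cdot N^{1/q-1/p}, & \text{if } 0<q\le p\le\infty;\\ 1, & \text{if } 0<p\le q\le\infty \text{ and } 1\le n\le N;\\ \big(\frac{N}{n}\big)^{1/p-1/q}, & \text{if } 0<p\le q\le\infty \text{ and } N\le n\le N^2;\\ 2^{-\frac{n}{N^2}}\cdot N^{1/q-1/p}, & \text{if } 0<p\le q\le\infty \text{ and } N^2\le n. \end{cases} \] (Where the ranges of several cases overlap, the two-sided estimate holds for each applicable expression.)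
   Context: $\mathbb{N}=\{1,2,\dots\}$. For $0<p\le\infty$ and $N\in\mathbb{N}$, the Schatten class $\mathcal{S}_p^N$ is the $N^2$-dimensional space of all real $N\times N$ matrices $A$ equipped with the (quasi-)norm $\|A\|_{\mathcal{S}_p^N}=\big(\sum_{j=1}^N\sigma_j(A)^p\big)^{1/p}$, where $\sigma_1(A)\ge\dots\ge\sigma_N(A)\ge 0$ are the singular values of $A$; for $p=\infty$, $\|A\|_{\mathcal{S}_\infty^N}=\sigma_1(A)$ is the operator norm. $\mathcal{S}_p^N\hookrightarrow\mathcal{S}_q^N$ denotes the identity map from $\mathcal{S}_p^N$ to $\mathcal{S}_q^N$. For a bounded linear operator $T:X\to Y$ between quasi-Banach spaces with closed unit balls $B_X,B_Y$, the $n$-th (dyadic) entropy number is \[ e_n(T)=\inf\Big\{\varepsilon>0:\ \exists\, y_1,\dots,y_{2^{n-1}}\in Y \text{ with } T(B_X)\subseteq\bigcup_{j=1}^{2^{n-1}}(y_j+\varepsilon B_Y)\Big\}. \] *)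

(* Defs.v *)
From HB Require Import structures.
From mathcomp Require Import all_boot all_order all_algebra.
From mathcomp Require Import all_classical all_reals all_analysis.
From mathcomp Require complex.

Set Implicit Arguments.
Unset Strict Implicit.
Unset Printing Implicit Defensive.

Import Order.TTheory GRing.Theory Num.Theory.

Local Open Scope classical_set_scope.
Local Open Scope ring_scope.

(* sigma_1 >= ... >= sigma_N >= 0 are the square roots of the eigenvalues of
   A^T A, counted with (algebraic) multiplicity. *)
Definition is_singular_values (R : realType) (N : nat) (A : 'M[R]_N)
    (s : N.-tuple R) : Prop :=
  [/\ sorted >=%R s, all (>= 0) s &
      char_poly (A^T *m A) = \prod_(x <- s) ('X - (x ^+ 2)%:P)].

(* The default value of xget is never used, see singular_valuesP. *)
Definition singular_values (R : realType) (N : nat) (A : 'M[R]_N) :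
    N.-tuple R :=
  xget [tuple 0 | _ < N] [set s | is_singular_values A s].

Section SingularValues.
Import complex.

Lemma char_poly_conj (F : fieldType) (N : nat) (P D : 'M[F]_N) :
  P \in unitmx -> char_poly (invmx P *m D *m P) = char_poly D.
Proof.
move=> Pu; rewrite /char_poly /char_poly_mx.
have PP : map_mx polyC (invmx P) *m map_mx polyC P = 1%:M.
  by rewrite -map_mxM mulVmx // map_mx1.
have -> : 'X%:M - map_mx polyC (invmx P *m D *m P) =
    map_mx polyC (invmx P) *m ('X%:M - map_mx polyC D) *m map_mx polyC P.
  by rewrite mulmxBr mulmxBl !map_mxM scalar_mxC -(mulmxA 'X%:M) PP mulmx1.
by rewrite !det_mulmx mulrAC -det_mulmx PP det1 mul1r.
Qed.

Lemma char_poly_gram (R : realType) (N : nat) (A : 'M[R]_N) :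
  exists2 d : 'I_N -> R, (forall i, 0 <= d i) &
    char_poly (A^T *m A) = \prod_(i < N) ('X - (d i)%:P).
Proof.
pose f : {rmorphism R -> R[i]} := real_complex R.
have fr x : f x \is Num.real by rewrite complex_real.
pose B := map_mx f A.
pose M := B^T *m B.
have Bc : map_mx Num.conj B = B.
  by apply/matrixP => i j; rewrite !mxE; apply/CrealP; rewrite fr.
have Mc : map_mx Num.conj M = M by rewrite /M map_mxM -map_trmx Bc.
have Msym : M \is hermsymmx.
  apply/is_hermitianmxP; rewrite expr0 scale1r.
  by rewrite -map_trmx Mc /M trmx_mul trmxK.
have Mn := hermitian_normalmx Msym.
have Pu := spectral_unitarymx M; have Pi := spectral_unit M.
have : M =
    invmx (spectralmx M) *m diag_mx (spectral_diag M) *m spectralmx M.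
  exact/orthomx_spectralP.
move: (spectralmx M) (spectral_diag M) Pu Pi => P s Pu Pi ME.
have s0 i : 0 <= s 0 i.
  have E : diag_mx s = P *m B^T *m (map_mx Num.conj (P *m B^T))^T.
    rewrite map_mxM -map_trmx Bc trmx_mul trmxK (map_trmx _ P) -invmx_unitary //.
    rewrite mulmxA -(mulmxA P) -/M ME -(mulmxA (invmx P)) mulKVmx //.
    by rewrite mulmxK.
  have /matrixP/(_ i i) := E; rewrite !mxE eqxx mulr1n => ->.
  by apply: sumr_ge0 => k _; rewrite !mxE -normCK exprn_ge0.
pose d i := complex.Re (s 0 i).
have dE i : f (d i) = s 0 i.
  have := s0 i; rewrite /d; case: (s 0 i) => a b.
  by rewrite lecE /= => /andP[/eqP-> _].
exists d.
  by move=> i; have := s0 i; rewrite -dE lecR.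
apply: (map_poly_inj f).
rewrite map_char_poly map_mxM -map_trmx -/B -/M ME char_poly_conj //.
rewrite char_poly_trig ?diag_mx_is_trig // rmorph_prod.
apply: eq_bigr => i _.
by rewrite rmorphB /= map_polyX map_polyC /= dE !mxE eqxx mulr1n.
Qed.
Lemma singular_values_ex (R : realType) (N : nat) (A : 'M[R]_N) :
  exists s : N.-tuple R, is_singular_values A s.
Proof.
have [d d0 dE] := char_poly_gram A.
pose t := sort >=%R [seq Num.sqrt (d i) | i <- enum 'I_N].
have sz : size t == N by rewrite size_sort size_map size_enum_ord.
exists (Tuple sz); split => /=.
- by apply: sort_sorted => x y; exact: le_total.
- by rewrite all_sort; apply/allP => _ /mapP[i _ ->]; exact: sqrtr_ge0.
- rewrite dE (perm_big _ (permEl (perm_sort _ _))) big_map /= big_enum /=.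
  by apply: eq_bigr => i _; rewrite sqr_sqrtr.
Qed.

End SingularValues.

Lemma singular_valuesP (R : realType) (N : nat) (A : 'M[R]_N) :
  is_singular_values A (singular_values A).
Proof. exact: (xgetPex _ (singular_values_ex A)). Qed.

(* In the second branch p is +oo; the value there is sigma_1. *)
Definition schatten_norm (R : realType) (N : nat) (p : \bar R) (A : 'M[R]_N) :
    R :=
  if p is r%:E then (\sum_(x <- singular_values A) x `^ r) `^ r^-1
  else nth 0 (singular_values A) 0.

Definition closed_unit_ball (R : realType) (X : lmodType R) (nX : X -> R) :
    set X :=
  [set x | nX x <= 1].

(* nX and nY are the quasi-norms of X and Y, and T is meant to be bounded with
   respect to them, so that the set below is nonempty.  Only n >= 1 is
   meaningful. *)
Definition entropy_number (R : realType) (X Y : lmodType R)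
    (nX : X -> R) (nY : Y -> R) (T : {linear X -> Y}) (n : nat) : R :=
  inf [set eps : R | 0 < eps /\
    exists y : 'I_(2 ^ n.-1) -> Y,
      T @` closed_unit_ball nX `<=`
        \bigcup_(j in [set: 'I_(2 ^ n.-1)])
          [set y j + eps *: b | b in closed_unit_ball nY]].

Definition schatten_entropy (R : realType) (p q : \bar R) (n N : nat) : R :=
  entropy_number (@schatten_norm R N p) (@schatten_norm R N q)
    (idfun : {linear 'M[R]_N -> 'M[R]_N}) n.

(* 1 / p, with 1 / oo = 0 *)
Definition recip (R : realType) (p : \bar R) : R := fine (p^-1)%E.

(* Phi p q n N v: v is the value at (n, N) of one of the applicable
   expressions; the ranges overlap, so this is not a function. *)
Variant Phi (R : realType) (p q : \bar R) (n N : nat) : R -> Prop :=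
| Phi_ge of (q <= p)%E :
    Phi p q n N
      (2 `^ (- (n%:R / (N ^ 2)%:R)) * N%:R `^ (recip q - recip p))
| Phi_le_small of (p <= q)%E & (1 <= n <= N)%N :
    Phi p q n N 1
| Phi_le_medium of (p <= q)%E & (N <= n <= N ^ 2)%N :
    Phi p q n N ((N%:R / n%:R) `^ (recip p - recip q))
| Phi_le_large of (p <= q)%E & (N ^ 2 <= n)%N :
    Phi p q n N
      (2 `^ (- (n%:R / (N ^ 2)%:R)) * N%:R `^ (recip q - recip p)).

(* Main.v *)
Require Import Defs.
From mathcomp Require Import all_boot all_order all_algebra.
From mathcomp Require Import all_classical all_reals all_analysis.
From mathcomp Require Import ring lra zify.

(** Write [u = 1/p] and [v = 1/q].  All the bounds come from one covering
    estimate (lemma [schatten_ball_covers]): for every [l], the unit ball of the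
    Schatten class of exponent [p] is covered by [2^(O(N 2^l))] balls of radius
    [2^(-u l)] for the operator norm.  For [p = +oo] a single ball suffices; for
    finite [p] the proof is by induction on [l].
    Differences of points in a common cell have operator norm at most
    [2 2^(-u l)] and bounded Schatten norm, so that, up to a small multiple of
    [2^(-u l)], they are matrices of rank [O(2^l)]; these factor as [X Y] with
    [X] and [Y] of width and height [O(2^l)], and the balls of such factors
    have nets of constant relative accuracy with [2^(O(N 2^l))] points.  As the
    accuracy is constant at each step, no logarithmic factor appears.

    The low-rank approximation is the Eckart-Young theorem
    ([low_rank_approximation], [singval_le_rank]), obtained from the
    diagonalization of the Gram matrix.  It also gives the inequality
    [sigma_(i+j)(A + B) <= sigma_i(A) + sigma_j(B)], hence the quasi-triangle
    inequality of the Schatten classes.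

    The dependence on the dimension is controlled by two facts on the unit ball
    of the operator norm on a space of matrices of dimension [D]: [M] balls of
    radius [eps] covering it satisfy [1 <= M eps^D] ([covers_opball_lower]), and
    [M <= (8 / eps)^D] balls suffice when [eps <= 1] ([covers_opball_upper]).
    Volumes are avoided: a covering, or a separated family, is iterated [k]
    times and compared with a cubic grid, and the constants depending on [D]
    disappear as [k] tends to infinity.

    Upper bounds.  Interpolating between [p] and infinity turns the covering
    estimate into [e_n <= C (N / n)^(u - v)] for [p <= q]; composing the
    estimate at [2^l ~ N] with a net of the operator norm ball gives
    [e_n <= C 2^(-n / N^2) N^(v - u)] for large [n].

    Lower bounds.  For [1 <= k <= N], consider the matrices supported on the
    first [k] columns, a space of dimension [N k].  There the operator norm ball
    is contained in [k^u] times the ball of exponent [p], while the ball of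
    exponent [q] is covered by [2^(O(N k))] operator norm balls of radius
    [k^(-v)].  Hence [e_n >= c 2^(-n / (N k)) k^(v - u)]
    ([schatten_cover_lower]), and [k = 1], [k = n / N], [k = N] give the three
    regimes. *)

Set Implicit Arguments.
Unset Strict Implicit.
Unset Printing Implicit Defensive.

Import Order.TTheory GRing.Theory Num.Theory.

Local Open Scope ring_scope.

(** * Orthogonal diagonalization of real symmetric matrices *)

Lemma mulmx_row_tr_eq0 (R : realDomainType) (n : nat) (w : 'rV[R]_n) :
  w *m w^T = 0 -> w = 0.
Proof.
move=> /matrixP/(_ 0 0); rewrite !mxE => /eqP; rewrite psumr_eq0; last first.
  by move=> i _; rewrite !mxE -expr2 sqr_ge0.
move=> /allP w0; apply/rowP => j; have := w0 j; rewrite mem_index_enum !mxE /=.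
by rewrite mulf_eq0 orbb => /(_ isT)/eqP.
Qed.

(** The Householder reflection swapping two given unit vectors. *)
Lemma householder (R : realFieldType) (n : nat) (u v : 'rV[R]_n) :
  u *m u^T = 1%:M -> v *m v^T = 1%:M ->
  exists H : 'M[R]_n, [/\ H^T = H, H *m H = 1%:M & u *m H = v].
Proof.
move=> uu vv; pose w := u - v; pose c := (w *m w^T) 0 0.
have wwE : w *m w^T = c%:M by rewrite [LHS]mx11_scalar.
have vuE : v *m u^T = u *m v^T.
  rewrite -[LHS]trmxK trmx_mul trmxK.
  by apply/matrixP => i j; rewrite mxE !ord1.
have uwE : u *m w^T = (c / 2)%:M.
  rewrite [LHS]mx11_scalar; congr (_%:M).
  rewrite /c /w linearB /= mulmxBr mulmxBl !mulmxBr uu vv vuE !mxE.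
  by field.
have [c0|c0] := eqVneq c 0.
  exists 1%:M; split; rewrite ?tr_scalar_mx ?mulmx1 //.
  apply/eqP; rewrite -subr_eq0; apply/eqP/mulmx_row_tr_eq0.
  by rewrite wwE c0 raddf0.
have WW : (w^T *m w) *m (w^T *m w) = c *: (w^T *m w).
  by rewrite mulmxA -(mulmxA _ w) wwE mul_mx_scalar scalemxAl.
exists (1%:M - (2 / c) *: (w^T *m w)); split.
- by rewrite linearB linearZ /= tr_scalar_mx trmx_mul trmxK.
- rewrite mulmxBr mulmx1 mulmxBl mul1mx -scalemxAr -scalemxAl WW.
  by apply/matrixP => i j; rewrite !mxE; field.
- rewrite mulmxBr mulmx1 -scalemxAr mulmxA uwE mul_scalar_mx scalerA.
  rewrite (_ : 2 / c * (c / 2) = 1); last by field.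
  by rewrite scale1r /w opprB addrC subrK.
Qed.

(** The eigenvalues are listed on the diagonal in the given order [s]. *)
Lemma symmetric_diagonalization (R : rcfType) (n : nat) (G : 'M[R]_n)
    (s : seq R) :
  G^T = G -> size s = n -> char_poly G = \prod_(x <- s) ('X - x%:P) ->
  exists2 Q : 'M[R]_n, Q *m Q^T = 1%:M &
    Q *m G *m Q^T = diag_mx (\row_i s`_i).
Proof.
elim: n G s => [|n IHn] G s Gs.
  move=> _ _; exists 1%:M; first by rewrite trmx1 mulmx1.
  by apply/matrixP => -[].
case: s => // x s [sz]; rewrite big_cons => Gp.
have /eigenvalueP[v vG v0] : eigenvalue G x.
  by rewrite eigenvalue_root_char Gp rootM root_XsubC eqxx.
wlog vv : v vG v0 / v *m v^T = 1%:M.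
  move=> W; pose c := (v *m v^T) 0 0.
  have c0 : 0 < c.
    rewrite lt_def; apply/andP; split.
      apply: contra_neq v0 => c0; apply: mulmx_row_tr_eq0.
      by rewrite [LHS]mx11_scalar -/c c0 raddf0.
    by rewrite /c !mxE; apply: sumr_ge0 => i _; rewrite !mxE -expr2 sqr_ge0.
  have s0 : 0 < Num.sqrt c by rewrite sqrtr_gt0.
  apply: (W ((Num.sqrt c)^-1 *: v)).
  - by rewrite -scalemxAl vG !scalerA mulrC.
  - by rewrite scaler_eq0 invr_eq0 gt_eqF.
  - rewrite linearZ /= -scalemxAl -scalemxAr scalerA [v *m _]mx11_scalar -/c.
    rewrite scale_scalar_mx -invfM -expr2 sqr_sqrtr ?ltW //.
    by rewrite mulVf ?gt_eqF.
(* The reflection [H] maps the eigenvector [v] to the first basis vector [e],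
   so that [x] splits off from [H G H] as a diagonal block. *)
pose e : 'rV[R]_(1 + n) := row_mx 1%:M 0.
have ee : e *m e^T = 1%:M.
  by rewrite /e tr_row_mx mul_row_col trmx1 mulmx1 mul0mx addr0.
have [H [Hs HH eH]] := householder ee vv.
pose G1 := H *m G *m H.
have G1s : G1^T = G1 by rewrite /G1 !trmx_mul Hs Gs mulmxA.
have eG1 : e *m G1 = x *: e.
  by rewrite /G1 !mulmxA eH vG -scalemxAl -eH -mulmxA HH mulmx1.
pose G2 := drsubmx (G1 : matrix R (1 + n) (1 + n)).
have [ulE urE] : ulsubmx (G1 : 'M[R]_(1 + n)) = x%:M /\
    ursubmx (G1 : 'M[R]_(1 + n)) = 0.
  have /eq_row_mx[-> ->] // : row_mx (ulsubmx (G1 : 'M[R]_(1 + n)))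
      (ursubmx (G1 : 'M[R]_(1 + n))) = row_mx x%:M 0.
  move: eG1; rewrite -{1}[G1](@submxK R 1 n 1 n) /e mul_row_block !mul1mx.
  by rewrite !mul0mx !addr0 scale_row_mx scaler0 scalemx1.
have dlE : dlsubmx (G1 : 'M[R]_(1 + n)) = 0.
  by rewrite -[G1]G1s -trmx_ursub urE trmx0.
have G1E : G1 = block_mx x%:M 0 0 G2.
  by rewrite -[LHS](@submxK R 1 n 1 n) ulE urE dlE.
have Hu : H \in unitmx by case/mulmx1_unit: HH.
have Hi : invmx H = H by rewrite -[LHS]mulmx1 -HH mulKmx.
have G2p : char_poly G2 = \prod_(x <- s) ('X - x%:P).
  have : char_poly G1 = ('X - x%:P) * char_poly G2.
    rewrite G1E /char_poly /char_poly_mx.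
    rewrite (map_block_mx _ (x%:M : matrix R 1 1)) !map_mx0.
    rewrite scalar_mx_block opp_block_mx add_block_mx !oppr0 !addr0.
    by rewrite det_ublock map_scalar_mx /= -raddfB /= det_scalar1.
  rewrite /G1 -{1}Hi char_poly_conj // Gp => /mulfI -> //.
  by rewrite polyXsubC_eq0.
have G2s : G2^T = G2 by rewrite /G2 trmx_drsub G1s.
have [Q QQ QG] := IHn G2 s G2s sz G2p.
pose Q1 : 'M[R]_(1 + n) := block_mx 1%:M 0 0 Q.
have Q1T : Q1^T = block_mx 1%:M 0 0 Q^T by rewrite tr_block_mx trmx1 !trmx0.
have Q1Q1 : Q1 *m Q1^T = 1%:M.
  rewrite Q1T mulmx_block !mul0mx !mulmx0 QQ mulmx1 !addr0 add0r.
  by rewrite -scalar_mx_block.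
have Q1G : Q1 *m block_mx x%:M 0 0 G2 *m Q1^T =
    diag_mx (row_mx (x%:M : matrix R 1 1) (\row_i s`_i)).
  rewrite Q1T !mulmx_block !mul0mx !mulmx0 !addr0 !add0r QG.
  rewrite mulmx1 mul1mx !mul0mx diag_mx_row; congr block_mx.
  by apply/matrixP => i j; rewrite !ord1 !mxE.
exists (Q1 *m H).
  by rewrite trmx_mul Hs mulmxA -(mulmxA Q1) HH mulmx1.
rewrite trmx_mul Hs !mulmxA -(mulmxA Q1 H) -(mulmxA Q1) -/G1 G1E.
rewrite [LHS]Q1G; congr diag_mx; apply/rowP => i; rewrite !mxE.
case: (@splitP 1 n i) => j -> /=; first by rewrite ord1 !mxE.
by rewrite mxE.
Qed.

(** * Operator norm balls *)

(** The squared Euclidean norm of a column vector. *)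
Definition sqnorm (R : nzRingType) (n : nat) (x : 'cV[R]_n) : R :=
  \sum_i x i 0 ^+ 2.

(** The closed ball of radius [t >= 0] for the operator norm
    [l_2^n -> l_2^m].  The inequality between squares avoids naming the norm
    itself. *)
Definition opball (R : numDomainType) (m n : nat) (t : R) (A : 'M[R]_(m, n)) :
    Prop :=
  forall x : 'cV_n, sqnorm (A *m x) <= t ^+ 2 * sqnorm x.

Section Opball.
Variable R : realFieldType.
Implicit Types (m n r : nat) (s t : R).

Lemma sqnormE n (x : 'cV[R]_n) : sqnorm x = (x^T *m x) 0 0.
Proof. by rewrite mxE; apply: eq_bigr => i _; rewrite mxE expr2. Qed.

Lemma sqnorm_ge0 n (x : 'cV[R]_n) : 0 <= sqnorm x.
Proof. by apply: sumr_ge0 => i _; exact: sqr_ge0. Qed.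

Lemma sqnorm_eq0 n (x : 'cV[R]_n) : sqnorm x = 0 -> x = 0.
Proof.
move=> x0; apply/trmx_inj; rewrite trmx0; apply: mulmx_row_tr_eq0.
by rewrite [LHS]mx11_scalar trmxK -sqnormE x0 raddf0.
Qed.

Lemma sqnorm_orthogonal m n (Q : 'M[R]_(m, n)) (x : 'cV_n) :
  Q^T *m Q = 1%:M -> sqnorm (Q *m x) = sqnorm x.
Proof.
by move=> QQ; rewrite !sqnormE trmx_mul mulmxA -(mulmxA _ Q^T) QQ mulmx1.
Qed.

Lemma opball0 m n t : opball t (0 : 'M[R]_(m, n)).
Proof.
move=> x; rewrite mul0mx {1}/sqnorm big1 => [|i _]; last by rewrite mxE expr0n.
by rewrite mulr_ge0 ?sqr_ge0 ?sqnorm_ge0.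
Qed.

Lemma opball_le m n s t (A : 'M[R]_(m, n)) :
  0 <= s -> s <= t -> opball s A -> opball t A.
Proof.
move=> s0 st As x; apply: le_trans (As x) _.
by rewrite ler_wpM2r ?sqnorm_ge0 // lerXn2r // nnegrE (le_trans s0).
Qed.

Lemma opballN m n t (A : 'M[R]_(m, n)) : opball t A -> opball t (- A).
Proof.
move=> At x; apply: le_trans (At x); rewrite mulNmx le_eqVlt; apply/orP; left.
by apply/eqP/eq_bigr => i _; rewrite mxE sqrrN.
Qed.

Lemma opballD m n s t (A B : 'M[R]_(m, n)) : 0 <= s -> 0 <= t ->
  opball s A -> opball t B -> opball (s + t) (A + B).
Proof.
move=> s0 t0 As Bt x; rewrite mulmxDl.
have z0 k (u : 'cV[R]_k) : sqnorm u <= 0 -> u = 0.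
  by move=> u0; apply: sqnorm_eq0; apply/eqP; rewrite eq_le u0 sqnorm_ge0.
move: s0; rewrite le_eqVlt => /predU1P[s0|s0].
  have -> : A *m x = 0.
    by apply: z0; have := As x; rewrite -s0 expr0n mul0r.
  by rewrite -s0 !add0r.
move: t0; rewrite le_eqVlt => /predU1P[t0|t0].
  have -> : B *m x = 0.
    by apply: z0; have := Bt x; rewrite -t0 expr0n mul0r.
  by rewrite -t0 !addr0.
(* Pointwise, s t (a + b)^2 <= (s + t) (t a^2 + s b^2). *)
have st0 : 0 < s * t by rewrite mulr_gt0.
rewrite -(ler_pM2l st0).
apply: (@le_trans _ _ ((s + t) * (t * sqnorm (A *m x) + s * sqnorm (B *m x)))).
  rewrite /sqnorm !mulr_sumr -big_split mulr_sumr ler_sum // => i _.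
  have -> : (A *m x + B *m x) i 0 = (A *m x) i 0 + (B *m x) i 0.
    by rewrite mxE.
  rewrite -subr_ge0.
  set a := (A *m x) i 0; set b := (B *m x) i 0.
  rewrite (_ : _ - _ = (t * a - s * b) ^+ 2) ?sqr_ge0 //=; ring.
have /(ler_wpM2l (ltW t0)) Ax := As x; have /(ler_wpM2l (ltW s0)) Bx := Bt x.
apply: le_trans (ler_wpM2l (addr_ge0 (ltW s0) (ltW t0)) (lerD Ax Bx)) _.
by rewrite le_eqVlt; apply/orP; left; apply/eqP; ring.
Qed.

Lemma opballB m n s t (A B : 'M[R]_(m, n)) : 0 <= s -> 0 <= t ->
  opball s A -> opball t B -> opball (s + t) (A - B).
Proof. by move=> s0 t0 As /opballN; exact: opballD. Qed.

Lemma opballZ m n t c (A : 'M[R]_(m, n)) :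
  opball t A -> opball (`|c| * t) (c *: A).
Proof.
move=> At x; rewrite -scalemxAl exprMn real_normK ?num_real // -mulrA.
have -> : sqnorm (c *: (A *m x)) = c ^+ 2 * sqnorm (A *m x).
  by rewrite /sqnorm mulr_sumr; apply: eq_bigr => i _; rewrite mxE exprMn.
by rewrite ler_wpM2l ?sqr_ge0.
Qed.

Lemma opballM m n r s t (A : 'M[R]_(m, n)) (B : 'M[R]_(n, r)) :
  opball s A -> opball t B -> opball (s * t) (A *m B).
Proof.
move=> As Bt x; rewrite -mulmxA; apply: le_trans (As _) _.
by rewrite exprMn -[leRHS]mulrA ler_wpM2l ?sqr_ge0.
Qed.

Lemma opball_orthogonal m n (Q : 'M[R]_(m, n)) : Q^T *m Q = 1%:M -> opball 1 Q.
Proof. by move=> QQ x; rewrite sqnorm_orthogonal // expr1n mul1r. Qed.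

Lemma pid_mx_diag n r :
  pid_mx r = diag_mx (\row_i (i < r)%N%:R) :> 'M[R]_n.
Proof.
apply/matrixP => i j; rewrite !mxE; have [->|] := eqVneq i j.
  by rewrite eqxx mulr1n.
by rewrite -val_eqE /= => /negPf->.
Qed.

Lemma opball_pid_mx m n r : opball 1 (pid_mx r : 'M[R]_(m, n)).
Proof.
move=> x; rewrite expr1n mul1r sqnormE trmx_mul mulmxA -(mulmxA _ _^T).
rewrite tr_pid_mx mul_pid_mx pid_mx_diag -mulmxA mxE; apply: ler_sum => i _.
rewrite mul_diag_mx !mxE; case: ltnP => _; first by rewrite mul1r.
by rewrite mul0r mulr0 sqr_ge0.
Qed.

Lemma opball_entry m n t (A : 'M[R]_(m, n)) i j :
  0 <= t -> opball t A -> `|A i j| <= t.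
Proof.
move=> t0 /(_ (delta_mx j 0)); rewrite -colE => Aj.
have E : sqnorm (delta_mx j 0 : 'cV[R]_n) = 1.
  rewrite /sqnorm (bigD1 j) //= big1 => [|k /negPf kj].
    by rewrite mxE !eqxx expr1n addr0.
  by rewrite mxE kj expr0n.
rewrite -(ler_pXn2r (n := 2)) ?nnegrE // real_normK ?num_real //.
apply: le_trans (_ : sqnorm (col j A) <= _); last by rewrite E mulr1 in Aj.
rewrite /sqnorm (bigD1 i) //= mxE lerDl.
by apply: sumr_ge0 => k _; exact: sqr_ge0.
Qed.

Lemma opball_sum m n (I : Type) (l : seq I) (t : I -> R)
    (A : I -> 'M[R]_(m, n)) :
  (forall i, 0 <= t i) -> (forall i, opball (t i) (A i)) ->
  opball (\sum_(i <- l) t i) (\sum_(i <- l) A i).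
Proof.
move=> t0 At; elim: l => [|i l IH]; first by rewrite !big_nil; exact: opball0.
by rewrite !big_cons; apply: opballD => //; exact: sumr_ge0.
Qed.

Lemma entries_opball m n t (A : 'M[R]_(m, n)) :
  0 <= t -> (forall i j, `|A i j| <= t) -> opball ((m * n)%:R * t) A.
Proof.
move=> t0 At; rewrite [A]matrix_sum_delta.
have delta1 i j : opball 1 (delta_mx i j : 'M[R]_(m, n)).
  move=> x; rewrite expr1n mul1r {1}/sqnorm (bigD1 i) //= big1 => [|k ki].
    rewrite addr0 mxE (bigD1 j) //= big1 => [|l lj]; last first.
      by rewrite mxE (negPf lj) andbF mul0r.
    rewrite mxE !eqxx mul1r addr0 /sqnorm (bigD1 j) //= lerDl.
    by apply: sumr_ge0 => l _; exact: sqr_ge0.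
  rewrite mxE big1 ?expr0n // => l _.
  by rewrite mxE (negPf ki) mul0r.
have -> : (m * n)%:R * t = \sum_(i < m) \sum_(j < n) t.
  by rewrite !sumr_const !card_ord -mulrnA mulnC mulr_natl.
apply: opball_sum => i; first exact: sumr_ge0.
apply: opball_sum => j //; rewrite -[X in opball X _]mulr1.
apply: opball_le (opballZ (A i j) (delta1 i j)); first by rewrite mulr1.
by rewrite !mulr1 At.
Qed.

End Opball.

(** * Singular values as approximation numbers *)

(** The [j]-th singular value, counted from [0]; it is [0] for [N <= j]. *)
Definition singval (R : realType) (N : nat) (A : 'M[R]_N) (j : nat) : R :=
  nth 0 (singular_values A) j.

Section SingularValues.
Variable R : realType.
Implicit Types (N r : nat) (t : R).

Lemma singval_ge0 N (A : 'M[R]_N) j : 0 <= singval A j.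
Proof.
have [_ s0 _] := singular_valuesP A; rewrite /singval.
have [jN|jN] := ltnP j (size (singular_values A)); last by rewrite nth_default.
exact: (allP s0) (mem_nth _ jN).
Qed.

Lemma singval_default N (A : 'M[R]_N) j : (N <= j)%N -> singval A j = 0.
Proof. by move=> Nj; rewrite /singval nth_default // size_tuple. Qed.

Lemma singval_nonincreasing N (A : 'M[R]_N) i j :
  (i <= j)%N -> singval A j <= singval A i.
Proof.
have [sS _ _] := singular_valuesP A; move=> ij.
have [jN|jN] := ltnP j N; last by rewrite (singval_default _ jN) singval_ge0.
apply: (sorted_leq_nth (leT := >=%R)) => //.
- by move=> x y z /= yx zx; apply: le_trans zx yx.
- by move=> x; exact: lexx.
- by rewrite ?inE size_tuple (leq_ltn_trans ij).
- by rewrite ?inE size_tuple.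
Qed.

Lemma gram_diagonalization N (A : 'M[R]_N) :
  exists2 Q : 'M[R]_N, Q *m Q^T = 1%:M &
    forall x, sqnorm (A *m (Q^T *m x)) =
      \sum_(i < N) singval A i ^+ 2 * x i 0 ^+ 2.
Proof.
have [_ _ sp] := singular_valuesP A.
have [|||Q QQ QG] := symmetric_diagonalization (G := A^T *m A)
    (s := [seq x ^+ 2 | x <- singular_values A]).
- by rewrite trmx_mul trmxK.
- by rewrite size_map size_tuple.
- by rewrite sp big_map.
exists Q => // x; rewrite sqnormE !trmx_mul trmxK !mulmxA.
rewrite -(mulmxA _ A^T) -(mulmxA x^T) -(mulmxA x^T) QG -mulmxA mxE.
apply: eq_bigr => i _; rewrite mul_diag_mx !mxE (nth_map 0) ?size_tuple //.
by rewrite /singval mulrCA expr2.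
Qed.

(** The upper half of the Eckart-Young theorem: truncating the singular value
    decomposition after [r] terms leaves an error of norm [singval A r]. *)
Lemma low_rank_approximation N r (A : 'M[R]_N) :
  exists X : 'M[R]_(N, r), exists Y : 'M[R]_(r, N),
    [/\ forall t, opball t A -> opball t X, opball 1 Y &
        opball (singval A r) (A - X *m Y)].
Proof.
have [Q QQ AQ] := gram_diagonalization A.
have QQ' : Q^T *m Q = 1%:M by apply: mulmx1C.
have Q1 : opball 1 Q by exact: opball_orthogonal.
have Qt1 : opball 1 Q^T by apply: opball_orthogonal; rewrite trmxK.
exists (A *m Q^T *m pid_mx r), (pid_mx r *m Q); split.
- move=> t At; rewrite -[t]mulr1; apply: opballM; last exact: opball_pid_mx.
  by rewrite -[t]mulr1; exact: opballM.
- by rewrite -[1]mulr1; apply: opballM => //; exact: opball_pid_mx.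
move=> x; rewrite mulmxA -(mulmxA (A *m Q^T)) pid_mx_id //.
have -> : (A - A *m Q^T *m pid_mx r *m Q) *m x =
    A *m (Q^T *m (copid_mx r *m (Q *m x))).
  rewrite !mulmxA; congr (_ *m _); rewrite /copid_mx mulmxBr mulmxBl.
  by rewrite mulmx1 -[A *m Q^T *m Q]mulmxA QQ' mulmx1.
rewrite AQ -(sqnorm_orthogonal x QQ') /sqnorm mulr_sumr; apply: ler_sum => i _.
rewrite /copid_mx pid_mx_diag mulmxBl mul1mx mul_diag_mx !mxE.
case: ltnP => ir; first by rewrite mul1r subrr expr0n mulr0 mulr_ge0 ?sqr_ge0.
rewrite mul0r subr0 ler_wpM2r ?sqr_ge0 // lerXn2r ?nnegrE ?singval_ge0 //.
exact: singval_nonincreasing.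
Qed.

(** The lower half of the Eckart-Young theorem: the kernel of a matrix [B] of
    rank at most [j] meets the span of the first [j + 1] right singular
    vectors of [A]. *)
Lemma singval_le_rank N j t (A B : 'M[R]_N) : 0 <= t ->
  (\rank B <= j)%N -> opball t (A - B) -> singval A j <= t.
Proof.
move=> t0 Bj AB; have [jN|jN] := ltnP j N; last by rewrite singval_default.
have [Q QQ AQ] := gram_diagonalization A.
pose J : 'M[R]_(N, j.+1) := pid_mx j.+1.
have JJ : J^T *m J = 1%:M.
  rewrite tr_pid_mx pid_mx_id // pid_mx_diag.
  by apply/matrixP => a b; rewrite !mxE ltn_ord.
pose K := (B *m Q^T *m J)^T.
have Kj : (\rank K <= j)%N.
  rewrite mxrank_tr -mulmxA; exact: leq_trans (mxrankM_maxl _ _) Bj.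
have : kermx K != 0 by rewrite kermx_eq0 /row_free ltn_eqF.
move=> /rowV0Pn[u /sub_kermxP uK u0].
pose y := Q^T *m (J *m u^T).
have By : B *m y = 0.
  apply: trmx_inj; rewrite trmx0 -uK /y !mulmxA trmx_mul trmxK; congr (_ *m _).
have yu : sqnorm y = sqnorm u^T.
  by rewrite /y !sqnorm_orthogonal // trmxK.
have u1 : 0 < sqnorm u^T.
  rewrite lt_def sqnorm_ge0 andbT; apply: contra_neq u0 => /sqnorm_eq0.
  by move/(congr1 trmx); rewrite trmxK trmx0.
have := AB y; rewrite mulmxBl By subr0 yu {1}/y AQ => le1.
rewrite -(ler_pXn2r (n := 2)) ?nnegrE ?singval_ge0 // -(ler_pM2r u1).
apply: le_trans le1; rewrite -(sqnorm_orthogonal u^T JJ) /sqnorm mulr_sumr.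
apply: ler_sum => i _; have [ij|ij] := leqP i j.
  rewrite ler_wpM2r ?sqr_ge0 // lerXn2r ?nnegrE ?singval_ge0 //.
  exact: singval_nonincreasing.
rewrite [(J *m u^T) i 0]mxE big1 ?expr0n ?mulr0 // => k _.
by rewrite !mxE [(i < j.+1)%N]ltnNge ij andbF mul0r.
Qed.

Lemma singval0P N t (A : 'M[R]_N) : 0 <= t -> singval A 0 <= t <-> opball t A.
Proof.
move=> t0; split=> At; last first.
  by apply: (@singval_le_rank _ _ _ _ 0) => //; rewrite ?mxrank0 ?subr0.
have [X [Y [_ _]]] := low_rank_approximation 0 A.
have -> : X *m Y = 0 by rewrite thinmx0 mul0mx.
by rewrite subr0; apply: opball_le => //; exact: singval_ge0.
Qed.

Lemma opball_singval N t (A : 'M[R]_N) j :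
  0 <= t -> opball t A -> singval A j <= t.
Proof.
by move=> t0 /(singval0P _ t0); apply: le_trans; exact: singval_nonincreasing.
Qed.

Lemma singval_rank N (A : 'M[R]_N) j : (\rank A <= j)%N -> singval A j = 0.
Proof.
move=> Aj; apply/eqP; rewrite eq_le singval_ge0 andbT.
by apply: (singval_le_rank _ Aj) => //; rewrite subrr; exact: opball0.
Qed.

Lemma singvalD N (A B : 'M[R]_N) i j :
  singval (A + B) (i + j) <= singval A i + singval B j.
Proof.
have [X [Y [_ _ XY]]] := low_rank_approximation i A.
have [Z [W [_ _ ZW]]] := low_rank_approximation j B.
apply: (@singval_le_rank _ _ _ _ (X *m Y + Z *m W)).
- by rewrite addr_ge0 ?singval_ge0.
- apply: leq_trans (mxrank_add _ _) _; apply: leq_add.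
    exact: leq_trans (mxrankM_maxl _ _) (rank_leq_col _).
  exact: leq_trans (mxrankM_maxl _ _) (rank_leq_col _).
by rewrite opprD addrACA; apply: opballD => //; exact: singval_ge0.
Qed.

Lemma singvalZ N c (A : 'M[R]_N) j : singval (c *: A) j <= `|c| * singval A j.
Proof.
have [X [Y [_ _ XY]]] := low_rank_approximation j A.
apply: (@singval_le_rank _ _ _ _ (c *: (X *m Y))).
- by rewrite mulr_ge0 ?singval_ge0.
- apply: leq_trans (mxrank_scale _ _) _.
  exact: leq_trans (mxrankM_maxl _ _) (rank_leq_col _).
by rewrite -scalerBr; exact: opballZ.
Qed.

Lemma singvalN N (A : 'M[R]_N) j : singval (- A) j <= singval A j.
Proof. by have := singvalZ (-1) A j; rewrite scaleN1r normrN1 mul1r. Qed.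

Lemma singvalB_double N (A B : 'M[R]_N) j :
  singval (A - B) j <= singval A j./2 + singval B j./2.
Proof.
apply: le_trans (lerD (lexx _) (singvalN B _)).
apply: le_trans (singvalD _ _ _ _).
by apply: singval_nonincreasing; rewrite addnn -{2}(odd_double_half j) leq_addl.
Qed.

End SingularValues.

(** * Coverings *)

(** [S] is covered by [M] translates of [T]. *)
Definition covers (V : zmodType) (S T : set V) (M : nat) : Prop :=
  exists y : 'I_M -> V, forall x, S x -> exists j, T (x - y j).

Section Covers.
Variable V : zmodType.
Implicit Types (S T U : set V) (M : nat).

Lemma covers_finType (I : finType) S T (y : I -> V) :
  (forall x, S x -> exists i, T (x - y i)) -> covers S T #|I|.
Proof.
move=> yST; exists (fun j => y (enum_val j)) => x /yST[i Ti].
by exists (enum_rank i); rewrite enum_rankK.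
Qed.

Lemma covers_trans T S U M M' :
  covers S T M -> covers T U M' -> covers S U (M * M').
Proof.
move=> [y yST] [z zTU].
have -> : (M * M' = #|{: 'I_M * 'I_M'}|)%N by rewrite card_prod !card_ord.
apply: (@covers_finType _ _ _ (fun i => y i.1 + z i.2)) => x /yST[i].
by move=> /zTU[j]; exists (i, j); rewrite opprD addrA.
Qed.

Lemma covers_leq M S T M' : (M <= M')%N -> covers S T M -> covers S T M'.
Proof.
move=> MM' [y yST].
exists (fun j => if insub (val j) is Some i then y i else 0) => x /yST[i Ti].
by exists (widen_ord MM' i); rewrite /= valK.
Qed.

Lemma covers1 S : covers S S 1.
Proof. by exists (fun=> 0) => x Sx; exists ord0; rewrite subr0. Qed.

Lemma covers_sub S S' T T' M : (S' `<=` S)%classic -> (T `<=` T')%classic ->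
  covers S T M -> covers S' T' M.
Proof.
by move=> SS TT [y yST]; exists y => x /SS/yST[j /TT]; exists j.
Qed.

(** The centres of a covering may be moved into the covered set, at the cost
    of replacing [T] by a set [U] containing the differences of points of [S]
    in a common translate of [T]. *)
Lemma covers_recenter S T U M :
  (forall x y, S x -> S y -> (exists c, T (x - c) /\ T (y - c)) -> U (x - y)) ->
  covers S T M -> covers S U M.
Proof.
move=> STU [y yST].
have /choice[z zP] : forall j, exists z,
    (exists x, S x /\ T (x - y j)) -> S z /\ T (z - y j).
  move=> j; have [[x xP]|no] := pselect (exists x, S x /\ T (x - y j)).
    by exists x.
  by exists 0.
exists z => x Sx; have [j Tj] := yST x Sx; exists j.
have [|Sz Tz] := zP j; first by exists x.
by apply: STU => //; exists (y j).
Qed.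

End Covers.

Lemma bernoulli_inequality (R : realDomainType) (y : R) k :
  0 <= y -> 1 + k%:R * y <= (1 + y) ^+ k.
Proof.
move=> y0; elim: k => [|k IH]; first by rewrite mul0r addr0 expr0.
rewrite exprS; apply: le_trans (ler_wpM2l _ IH); last by rewrite addr_ge0.
rewrite -subr_ge0 -natr1.
rewrite (_ : _ - _ = k%:R * y ^+ 2); last by ring.
by rewrite mulr_ge0 ?sqr_ge0.
Qed.

(** This is how dimensional constants disappear: [C] plays no role. *)
Lemma expr_bounded_le1 (R : archiRealFieldType) (x C : R) :
  (forall k, x ^+ k <= C) -> x <= 1.
Proof.
move=> xC; rewrite leNgt; apply/negP => x1; pose y := x - 1.
have y0 : 0 < y by rewrite subr_gt0.
have C0 : 0 <= C by apply: le_trans (xC 0); rewrite expr0.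
have := xC (Num.truncn (C / y)).+1; rewrite leNgt => /negP[].
have -> : x = 1 + y by rewrite /y; ring.
apply: lt_le_trans (bernoulli_inequality _ (ltW y0)).
have /truncn_itv/andP[_] : 0 <= C / y by rewrite divr_ge0 // ltW.
rewrite ltr_pdivrMr // => /lt_trans; apply; lra.
Qed.

Section OpballCovers.
Variable R : realType.
Implicit Types (m n M k : nat) (eps s t : R).

Lemma covers_opballZ m n M s t eps : 0 < s ->
  covers (@opball R m n t) (@opball R m n eps) M ->
  covers (@opball R m n (s * t)) (@opball R m n (s * eps)) M.
Proof.
move=> s0 [y yP]; exists (fun j => s *: y j) => A At.
have [|j] := yP (s^-1 *: A).
  by have := opballZ s^-1 At; rewrite gtr0_norm ?invr_gt0 // mulKf ?gt_eqF.
move=> /(opballZ s); rewrite gtr0_norm // scalerBr scalerA divff ?gt_eqF //.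
by rewrite scale1r; exists j.
Qed.

Lemma covers_opball_iter m n M eps k : 0 < eps ->
  covers (@opball R m n 1) (@opball R m n eps) M ->
  covers (@opball R m n 1) (@opball R m n (eps ^+ k)) (M ^ k).
Proof.
move=> eps0 yP; elim: k => [|k IH]; first by rewrite expr0; exact: covers1.
rewrite expnSr exprSr; apply: covers_trans IH _.
rewrite -[X in covers (opball X)]mulr1.
by apply: covers_opballZ; rewrite ?exprn_gt0.
Qed.

(** A substitute for the comparison of volumes: the cover is iterated [k]
    times, and the resulting tiny balls are compared with the points of a cubic
    grid; the dimensional constant disappears as [k] grows. *)
Lemma covers_opball_lower m n M eps : 0 < eps ->
  covers (@opball R m n 1) (@opball R m n eps) M ->
  1 <= M%:R * eps ^+ (m * n).
Proof.
move=> eps0 yP; set D := (m * n)%N; pose c : R := D.+1%:R.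
have c0 : 0 < c by [].
have M0 : (0 < M)%N.
  case: yP => y /(_ 0 (@opball0 R m n 1))[j _].
  exact: leq_ltn_trans (ltn_ord j).
have x0 : 0 < M%:R * eps ^+ D by rewrite mulr_gt0 ?ltr0n ?exprn_gt0.
suff H k : (M%:R * eps ^+ D)^-1 ^+ k <= (4 * c) ^+ D.
  by rewrite -(invr_le1 _ x0) ?unitfE ?gt_eqF //; exact: expr_bounded_le1 H.
pose e := eps ^+ k; have e0 : 0 < e by exact: exprn_gt0.
suff H : (4 * c * e) ^- D <= (M ^ k)%:R.
  rewrite exprVn exprMn -exprM (mulnC D) exprM -/e -natrX.
  rewrite invf_ple ?posrE ?mulr_gt0 ?exprn_gt0 ?mulr_gt0 //;
    rewrite ?ltr0n ?expn_gt0 ?M0 //.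
  move: H; rewrite exprMn invfM => H.
  by rewrite -ler_pdivrMr ?exprn_gt0.
have Mk : (1 <= M ^ k)%N by rewrite expn_gt0 M0.
have ce0 : 0 < 4 * c * e by rewrite !mulr_gt0.
have [ce1|ce1] := leP 1 (4 * c * e).
  apply: (@le_trans _ _ 1); last by rewrite ler1n.
  by rewrite invf_le1 ?exprn_gt0 // exprn_ege1.
(* The mesh of the grid satisfies [2 e < 1 / (c g) < 4 e]. *)
pose g := (Num.truncn (4 * c * e)^-1).+1.
have /truncn_itv/andP[g1 g2] : 0 <= (4 * c * e)^-1 by rewrite invr_ge0 ltW.
apply: (@le_trans _ _ (g ^ D)%:R).
  by rewrite -exprVn natrX lerXn2r ?nnegrE ?invr_ge0 ?ltW.
rewrite ler_nat -[g in (g ^ _)%N]card_ord -card_mx -[leqRHS]card_ord.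
have [y yeP] := covers_opball_iter k eps0 yP.
have cg0 : 0 < c * g%:R by rewrite mulr_gt0 ?ltr0n.
pose A (F : 'M['I_g]_(m, n)) : 'M[R]_(m, n) :=
  \matrix_(i, j) ((F i j)%:R / (c * g%:R)).
have A1 F : opball 1 (A F).
  apply: opball_le (entries_opball (t := c^-1) _ _).
  - by rewrite mulr_ge0 ?ler0n // invr_ge0 ltW.
  - by rewrite ler_pdivrMr // mul1r ler_nat leqnSn.
  - by rewrite invr_ge0 ltW.
  move=> i j; rewrite mxE ger0_norm; last by rewrite divr_ge0 ?ler0n // ltW.
  rewrite ler_pdivrMr // mulKf ?gt_eqF // ler_nat; exact: ltnW.
have /choice[h hP] F : exists j, opball e (A F - y j) by exact: yeP.
apply: (leq_card h) => F G hFG; apply/matrixP => i j; apply/val_inj/eqP.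
apply: contraT => FG.
have : opball (e + e) (A F - A G).
  have -> : A F - A G = (A F - y (h F)) - (A G - y (h G)).
    by rewrite hFG opprB addrA subrK.
  by apply: opballB; rewrite ?ltW.
move=> /(opball_entry i j) H.
have {H} : `|(A F - A G) i j| <= e + e by apply: H; rewrite addr_ge0 ?ltW.
rewrite leNgt => /negP[].
rewrite !mxE -mulrBl normrM [`|_^-1|]gtr0_norm ?invr_gt0 //.
rewrite ltr_pdivlMr //; apply: (@lt_le_trans _ _ 1).
  have : 2 * (c * e) * g%:R <= 2 * (c * e) * ((4 * c * e)^-1 + 1).
    rewrite ler_wpM2l ?mulr_ge0 ?(ltW c0) ?(ltW e0) //.
    by rewrite /g -[leLHS]natr1 lerD2r.
  rewrite mulrDr (_ : 2 * (c * e) * (4 * c * e)^-1 = 2^-1); last first.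
    by field; rewrite !gt_eqF.
  rewrite (_ : (e + e) * _ = 2 * (c * e) * g%:R); last by ring.
  move=> /le_lt_trans; apply; move: ce1; rewrite -mulrA.
  move: (c * e) => ce; lra.
rewrite -[(F i j)%:R]/((F i j : nat)%:~R) -[(G i j)%:R]/((G i j : nat)%:~R).
rewrite -rmorphB -intr_norm ler1z.
move: FG => /=; move: (nat_of_ord (F i j)) (nat_of_ord (G i j)) => a b; lia.
Qed.

End OpballCovers.

Section Packing.
Variable R : realType.
Implicit Types (m n M k : nat) (eps s t : R).

(** An [eps]-separated family in the unit ball is replicated at the scales
    [1], [eps / 8], ..., [(eps / 8) ^+ k.-1], giving all the points
    [x_(i_1) + (eps / 8) (x_(i_2) + (eps / 8) (...))]. *)
Lemma iterated_packing (I : finType) m n eps (x : I -> 'M[R]_(m, n)) k :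
  0 < eps -> eps <= 1 -> (forall i, opball 1 (x i)) ->
  (forall i j, i != j -> ~ opball eps (x i - x j)) ->
  exists (F : finType) (z : F -> 'M[R]_(m, n)),
    [/\ #|F| = (#|I| ^ k)%N, forall a, opball 2 (z a) &
        forall a b, a != b -> ~ opball ((eps / 8) ^+ k) (z a - z b)].
Proof.
move=> eps0 eps1 x1 xsep; pose d := eps / 8.
have d0 : 0 < d by rewrite divr_gt0.
elim: k => [|k [F [z [Fk z2 zsep]]]].
  exists unit, (fun=> 0); split; first by rewrite card_unit.
    by move=> _; exact: opball0.
  by case; case.
exists (I * F)%type, (fun a => x a.1 + d *: z a.2); split.
- by rewrite card_prod Fk expnS.
- move=> a; apply: (@opball_le _ _ _ (1 + `|d| * 2)).
  + by rewrite addr_ge0 ?mulr_ge0.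
  + rewrite gtr0_norm // /d; lra.
  + by apply: opballD => //; rewrite ?mulr_ge0 //; apply: opballZ.
move=> [i a] [j b] /= neq; rewrite -/d => close.
have [ij|ij] := eqVneq i j; last first.
  apply: (xsep i j ij).
  have -> : x i - x j =
      (x i + d *: z a - (x j + d *: z b)) - d *: (z a - z b).
    by rewrite scalerBr opprD addrACA addrK.
  have dk : d ^+ k.+1 <= d.
    rewrite exprS ler_piMr ?(ltW d0) // exprn_ile1 ?(ltW d0) // /d; lra.
  apply: (@opball_le _ _ _ (d ^+ k.+1 + `|d| * (2 + 2))).
  + by rewrite addr_ge0 ?exprn_ge0 ?(ltW d0).
  + rewrite gtr0_norm //; apply: le_trans (lerD dk (lexx _)) _; rewrite /d; lra.
  + apply: opballB => //; first by rewrite exprn_ge0 ?(ltW d0).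
    by apply: opballZ; exact: opballB.
have ab : a != b by apply: contraNneq neq => ->; rewrite ij.
apply: (zsep a b ab); rewrite -/d.
have -> : z a - z b = d^-1 *: (x i + d *: z a - (x j + d *: z b)).
  rewrite ij opprD addrACA subrr add0r -scalerBr scalerA mulVf ?scale1r //.
  by rewrite gt_eqF.
have := opballZ d^-1 close.
by rewrite gtr0_norm ?invr_gt0 // exprS mulKf ?gt_eqF.
Qed.

(** A family in the ball of radius [2] without two points at distance [<= s]
    has at most [C / s ^ D] points, where [C] depends on the dimension [D]
    only: two points in the same cell of a cubic grid are close. *)
Lemma grid_packing (F : finType) m n s (z : F -> 'M[R]_(m, n)) :
  0 < s -> s <= 1 -> (forall a, opball 2 (z a)) ->
  (forall a b, a != b -> ~ opball s (z a - z b)) ->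
  #|F|%:R * s ^+ (m * n) <= (5 * (m * n).+1%:R) ^+ (m * n).
Proof.
move=> s0 s1 z2 zsep; set D := (m * n)%N; pose c : R := D.+1%:R.
have c0 : 0 < c by [].
have c1 : 1 <= c by rewrite ler1n.
pose h := s / c; have h0 : 0 < h by rewrite divr_gt0.
pose g := (Num.truncn (4 / h)).+1.
have hr0 : 0 <= 4 / h by rewrite divr_ge0 // ltW.
have zb a i j : 0 <= (z a i j + 2) / h <= 4 / h.
  have := opball_entry i j (ler0n _ 2) (z2 a).
  rewrite ler_norml => /andP[z1 z3].
  rewrite divr_ge0 ?(ltW h0) //=; last by lra.
  by rewrite ler_pM2r ?invr_gt0 //; lra.
have cellP a i j : (Num.truncn ((z a i j + 2) / h) < g)%N.
  by rewrite ltnS le_truncn //; case/andP: (zb a i j).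
pose cell a : 'M['I_g]_(m, n) := \matrix_(i, j) Ordinal (cellP a i j).
have cell_inj : injective cell.
  move=> a b /matrixP ab; apply/eqP; apply: contraT => /zsep[].
  apply: (@opball_le _ _ _ (D%:R * h)).
  - by rewrite mulr_ge0 // ltW.
  - rewrite /h mulrCA ler_piMr ?(ltW s0) // ler_pdivrMr // mul1r.
    by rewrite ler_nat leqnSn.
  apply: entries_opball => [|i j]; first exact: ltW.
  have -> : (z a - z b) i j = z a i j - z b i j by rewrite !mxE.
  have := ab i j; rewrite !mxE => /(congr1 val) /= E.
  have /andP[a0 _] := zb a i j; have /andP[b0 _] := zb b i j.
  have /andP[a1 a2] := truncn_itv a0; have /andP[b1 b2] := truncn_itv b0.
  rewrite E in a1 a2; move: a1 a2 b1 b2.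
  rewrite ler_pdivlMr // ltr_pdivrMr // ler_pdivlMr // ltr_pdivrMr //.
  move: (Num.truncn _) => w; rewrite -natr1 => a1 a2 b1 b2.
  by rewrite ler_norml; apply/andP; split; lra.
have := leq_card cell cell_inj; rewrite card_mx card_ord -/D -(ler_nat R) => Fg.
apply: le_trans (ler_wpM2r (exprn_ge0 _ (ltW s0)) Fg) _.
rewrite natrX -exprMn lerXn2r ?nnegrE ?mulr_ge0 ?(ltW s0) ?(ltW c0) // -/c.
have /truncn_itv/andP[g1 _] := hr0.
have : g%:R <= 5 / h.
  rewrite /g -[leLHS]natr1; apply: le_trans (lerD g1 (lexx 1)) _.
  rewrite -[leLHS]/(4 / h + 1).
  have : 1 <= h^-1.
    rewrite invf_ge1 // /h ler_pdivrMr // mul1r; exact: le_trans s1 c1.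
  lra.
move=> /(ler_wpM2r (ltW s0))/le_trans; apply.
rewrite /h invfM invrK -mulrA -(mulrA s^-1) (mulrC c) mulKf ?gt_eqF //.
Qed.

Lemma packing_bound (I : finType) m n eps (x : I -> 'M[R]_(m, n)) :
  0 < eps -> eps <= 1 -> (forall i, opball 1 (x i)) ->
  (forall i j, i != j -> ~ opball eps (x i - x j)) ->
  #|I|%:R * (eps / 8) ^+ (m * n) <= 1.
Proof.
move=> eps0 eps1 x1 xsep; have d0 : 0 < eps / 8 by rewrite divr_gt0.
apply: (@expr_bounded_le1 _ _ ((5 * (m * n).+1%:R) ^+ (m * n))) => k.
have [F [z [Fk z2 zsep]]] := iterated_packing k eps0 eps1 x1 xsep.
rewrite exprMn -exprM mulnC exprM -natrX -Fk.
apply: grid_packing z2 zsep; first by rewrite exprn_gt0.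
by rewrite exprn_ile1 ?(ltW d0) //; lra.
Qed.

(** A maximal separated family is a net. *)
Lemma covers_opball_upper m n eps : 0 < eps -> eps <= 1 ->
  exists2 M, M%:R * (eps / 8) ^+ (m * n) <= 1 &
    covers (@opball R m n 1) (@opball R m n eps) M.
Proof.
move=> eps0 eps1; have d0 : 0 < eps / 8 by rewrite divr_gt0.
pose sep M := exists x : 'I_M -> 'M[R]_(m, n), (forall i, opball 1 (x i)) /\
  (forall i j, i != j -> ~ opball eps (x i - x j)).
have sepB M : sep M -> M%:R * (eps / 8) ^+ (m * n) <= 1.
  move=> [x [x1 xs]]; have := packing_bound eps0 eps1 x1 xs.
  by rewrite card_ord.
have ex0 : exists M, `[< sep M >].
  by exists 0%N; apply/asboolP; exists (fun=> 0); split; case.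
have bnd M : `[< sep M >] -> (M <= Num.truncn ((eps / 8) ^+ (m * n))^-1)%N.
  move=> /asboolP/sepB; rewrite -ler_pdivlMr ?exprn_gt0 // mul1r => MB.
  by rewrite truncn_ge_nat // invr_ge0 exprn_ge0 // ltW.
have [M /asboolP sM maxM] := ex_maxnP ex0 bnd; exists M; first exact: sepB.
case: (sM) => x [x1 xs]; exists x => A A1.
apply: contrapT => /forallNP far.
suff /asboolP/maxM : sep M.+1 by rewrite ltnn.
exists (fun i => if unlift ord_max i is Some j then x j else A); split.
  by move=> i; case: unliftP.
move=> i j; case: unliftP => [i' ->|->]; case: unliftP => [j' ->|->].
- by rewrite (inj_eq lift_inj); exact: xs.
- by move=> _ /opballN; rewrite opprB; exact: far.
- by move=> _; exact: far.
- by rewrite eqxx.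
Qed.

End Packing.

(** * Schatten norms *)

Section SchattenNorm.
Variable R : realType.
Implicit Types (p q : \bar R) (r t a : R) (N k : nat).

Lemma exponent_cases p : (0 < p)%E -> p = +oo%E \/ exists2 r, 0 < r & p = r%:E.
Proof.
case: p => [r| |] //; last by left.
by rewrite lte_fin => r0; right; exists r.
Qed.

Lemma recip_oo : recip (+oo%E : \bar R) = 0.
Proof. by rewrite /recip invey. Qed.

Lemma recip_fin r : recip r%:E = r^-1.
Proof. exact: fine_invr. Qed.

Lemma recip_ge0 p : (0 < p)%E -> 0 <= recip p.
Proof.
case/exponent_cases => [->|[r r0 ->]]; first by rewrite recip_oo.
by rewrite recip_fin invr_ge0 ltW.
Qed.

Lemma recip_le p q : (0 < p)%E -> (p <= q)%E -> recip q <= recip p.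
Proof.
move=> p0 pq; have q0 : (0 < q)%E by apply: lt_le_trans pq.
have [qE|[s s0 qE]] := exponent_cases q0.
  by rewrite qE recip_oo recip_ge0.
have [pE|[r r0 pE]] := exponent_cases p0; first by rewrite pE qE in pq.
rewrite pE qE !recip_fin lef_pV2 ?posrE //.
by rewrite pE qE lee_fin in pq.
Qed.

Lemma powR_root_le r (x t : R) : 0 < r -> 0 <= x -> 0 <= t ->
  (x `^ r^-1 <= t) = (x <= t `^ r).
Proof.
move=> r0 x0 t0; have rV0 : 0 <= r^-1 by rewrite invr_ge0 ltW.
apply/idP/idP => [xt|xt].
  have := ge0_ler_powR (ltW r0) (powR_ge0 _ _ : _ \in Num.nneg) t0 xt.
  by rewrite -powRrM mulVf ?gt_eqF // powRr1.
have := ge0_ler_powR rV0 x0 (powR_ge0 _ _ : _ \in Num.nneg) xt.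
by rewrite -powRrM mulfV ?gt_eqF // powRr1.
Qed.

Lemma le_powR r (x y : R) : 0 <= r -> 0 <= x -> x <= y -> x `^ r <= y `^ r.
Proof.
move=> r0 x0 xy; apply: ge0_ler_powR => //; rewrite nnegrE //.
exact: le_trans xy.
Qed.

Lemma one_powR r : 1 `^ r = 1 :> R.
Proof. by rewrite powR1. Qed.

Lemma schatten_oo N (A : 'M[R]_N) : schatten_norm +oo%E A = singval A 0.
Proof. by []. Qed.

Lemma schatten_fin N r (A : 'M[R]_N) :
  schatten_norm r%:E A = (\sum_(i < N) singval A i `^ r) `^ r^-1.
Proof.
by rewrite /schatten_norm (big_nth 0) big_mkord size_tuple.
Qed.

Lemma schatten_ge0 N p (A : 'M[R]_N) : (0 < p)%E -> 0 <= schatten_norm p A.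
Proof.
case/exponent_cases => [->|[r _ ->]]; first exact: singval_ge0.
exact: powR_ge0.
Qed.

Lemma schatten_fin_le N r t (A : 'M[R]_N) : 0 < r -> 0 <= t ->
  (schatten_norm r%:E A <= t) = (\sum_(i < N) singval A i `^ r <= t `^ r).
Proof.
move=> r0 t0; rewrite schatten_fin powR_root_le //.
by apply: sumr_ge0 => i _; exact: powR_ge0.
Qed.

Lemma schatten_mono N p t (A B : 'M[R]_N) : (0 < p)%E -> 0 <= t ->
  (forall j, singval A j <= t * singval B j) ->
  schatten_norm p A <= t * schatten_norm p B.
Proof.
case/exponent_cases => [->|[r r0 ->]] t0 AB; first exact: AB.
rewrite schatten_fin_le // ?mulr_ge0 ?schatten_ge0 ?lte_fin //.
rewrite powRM ?schatten_ge0 ?lte_fin // schatten_fin.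
have S0 : 0 <= \sum_(i < N) singval B i `^ r.
  by apply: sumr_ge0 => i _; exact: powR_ge0.
rewrite -[X in _ <= _ * X]powRrM mulVf ?gt_eqF // powRr1 // mulr_sumr.
apply: ler_sum => i _; rewrite -powRM ?singval_ge0 //.
exact: le_powR (ltW r0) (singval_ge0 _ _) (AB i).
Qed.

Lemma schattenZ N p c (A : 'M[R]_N) : (0 < p)%E ->
  schatten_norm p (c *: A) <= `|c| * schatten_norm p A.
Proof. by move=> p0; apply: schatten_mono => // j; exact: singvalZ. Qed.

(** Markov's inequality: the weak Schatten norm is bounded by the norm. *)
Lemma singval_le_schatten N p a (A : 'M[R]_N) j : (0 < p)%E -> 0 <= a ->
  schatten_norm p A <= a -> singval A j <= a * j.+1%:R `^ (- recip p).
Proof.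
case/exponent_cases => [->|[r r0 ->]] a0.
  rewrite recip_oo oppr0 powRr0 mulr1 schatten_oo; apply: le_trans.
  exact: singval_nonincreasing.
rewrite schatten_fin_le // recip_fin => Aa.
have [jN|jN] := ltnP j N; last first.
  by rewrite singval_default // mulr_ge0 ?powR_ge0.
rewrite powRN ler_pdivlMr ?powR_gt0 //.
have -> : singval A j * j.+1%:R `^ r^-1 =
    (singval A j `^ r * j.+1%:R) `^ r^-1.
  by rewrite powRM ?powR_ge0 // -powRrM mulfV ?gt_eqF // powRr1 ?singval_ge0.
rewrite powR_root_le ?mulr_ge0 ?powR_ge0 //; apply: le_trans Aa.
rewrite (bigID (fun i : 'I_N => (i < j.+1)%N)) /=.
rewrite -(big_ord_widen N (fun i => singval A i `^ r)) //.
apply: ler_wpDr; first by apply: sumr_ge0 => i _; exact: powR_ge0.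
rewrite mulr_natr -[in leLHS](card_ord j.+1) -sumr_const; apply: ler_sum => i _.
apply: le_powR (ltW r0) (singval_ge0 _ _) _; apply: singval_nonincreasing.
by rewrite -ltnS.
Qed.

Lemma schatten_opball N p a (A : 'M[R]_N) : (0 < p)%E -> 0 <= a ->
  schatten_norm p A <= a -> opball a A.
Proof.
move=> p0 a0 Aa; apply/singval0P => //.
by have := singval_le_schatten 0 p0 a0 Aa; rewrite powR1 mulr1.
Qed.

Lemma schatten_le_rank N p k t (A : 'M[R]_N) : (0 < p)%E -> 0 <= t ->
  (k <= N)%N -> opball t A -> (\rank A <= k)%N ->
  schatten_norm p A <= t * k%:R `^ recip p.
Proof.
case/exponent_cases => [->|[r r0 ->]] t0 kN At rA.
  by rewrite recip_oo powRr0 mulr1 schatten_oo; exact: opball_singval.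
rewrite schatten_fin_le ?mulr_ge0 ?powR_ge0 // recip_fin.
rewrite powRM ?powR_ge0 // -powRrM mulVf ?gt_eqF // powRr1 //.
rewrite (bigID (fun i : 'I_N => (i < k)%N)) /= [X in _ + X]big1 => [|i].
  rewrite addr0 -(big_ord_widen N (fun i => singval A i `^ r)) //.
  rewrite mulr_natr -[in leRHS](card_ord k) -sumr_const; apply: ler_sum => i _.
  exact: le_powR (ltW r0) (singval_ge0 _ _) (opball_singval _ t0 At).
rewrite -leqNgt => ki; rewrite singval_rank ?(leq_trans rA) //.
by rewrite powR0 ?gt_eqF.
Qed.

Lemma sum_half_le N (f g : nat -> R) : (forall i, 0 <= g i) ->
  (forall i, f i <= g i./2) ->
  \sum_(i < N) f i <= 2 * \sum_(i < N) g i.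
Proof.
move=> g0 fg; apply: (@le_trans _ _ (\sum_(i < N) g i./2)).
  by apply: ler_sum => i _; exact: fg.
have E k : \sum_(i < k.*2) g i./2 = 2 * \sum_(i < k) g i.
  elim: k => [|k IH]; first by rewrite !big_ord0 mulr0.
  rewrite doubleS !big_ord_recr /= IH uphalf_double doubleK; ring.
rewrite -E (big_ord_widen N.*2 (fun i => g i./2)) -?addnn ?leq_addr //.
by rewrite big_mkcond ler_sum // => i _; case: ifP.
Qed.

Lemma powRD_le r (x y : R) : 0 <= r -> 0 <= x -> 0 <= y ->
  (x + y) `^ r <= 2 `^ r * (x `^ r + y `^ r).
Proof.
move=> r0; wlog xy : x y / x <= y.
  move=> W x0 y0; have [xy|/ltW yx] := leP x y; first exact: W.
  by rewrite addrC [in leRHS]addrC; exact: W.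
move=> x0 y0; apply: (@le_trans _ _ (2 `^ r * y `^ r)).
  by rewrite -powRM //; apply: le_powR; rewrite ?addr_ge0 //; lra.
by rewrite ler_wpM2l ?powR_ge0 // lerDr powR_ge0.
Qed.

Lemma schatten_quasi_triangle p : (0 < p)%E -> exists2 K : R, 1 <= K &
  forall N (A B : 'M[R]_N), schatten_norm p A <= 1 -> schatten_norm p B <= 1 ->
    schatten_norm p (A - B) <= K.
Proof.
case/exponent_cases => [->|[r r0 ->]].
  exists 2 => [|N A B]; first by rewrite ler1n.
  rewrite !schatten_oo => A1 B1; apply: le_trans (singvalB_double _ _ _) _.
  exact: lerD A1 B1.
have rV0 : 0 <= r^-1 by rewrite invr_ge0 ltW.
have c1 : 1 <= 2 `^ r :> R by rewrite -[leLHS](powRr0 2) ler_powR ?ler1n // ltW.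
have c0 : 0 <= 4 * 2 `^ r :> R by rewrite mulr_ge0 ?powR_ge0.
exists ((4 * 2 `^ r) `^ r^-1) => [|N A B].
  by rewrite -[leLHS](one_powR r^-1); apply: le_powR => //; move: c1; lra.
move=> A1 B1.
rewrite (schatten_fin_le _ r0 ler01) one_powR in A1.
rewrite (schatten_fin_le _ r0 ler01) one_powR in B1.
rewrite (schatten_fin_le _ r0 (powR_ge0 _ _)).
rewrite -powRrM mulVf ?gt_eqF // powRr1 //.
apply: (@le_trans _ _ (2 * \sum_(i < N)
    2 `^ r * (singval A i `^ r + singval B i `^ r))).
  apply: (@sum_half_le N (fun i => singval (A - B) i `^ r)
    (fun i => 2 `^ r * (singval A i `^ r + singval B i `^ r))).
    by move=> i; rewrite mulr_ge0 ?addr_ge0 ?powR_ge0.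
  move=> i.
  apply: le_trans (powRD_le (ltW r0) (singval_ge0 _ _) (singval_ge0 _ _)).
  exact: le_powR (ltW r0) (singval_ge0 _ _) (singvalB_double _ _ _).
rewrite -mulr_sumr big_split /=.
rewrite [4 * _](_ : _ = 2 * (2 `^ r * (1 + 1))); last by ring.
apply: ler_wpM2l => //; apply: ler_wpM2l; first exact: powR_ge0.
exact: lerD A1 B1.
Qed.

(** For finite [p] and [q] this is
    [\sum sigma_j^q <= sigma_0^(q - p) \sum sigma_j^p]; the conventions on
    division make the formula correct when [p] or [q] is infinite. *)
Lemma schatten_interpolation N p q a t (A : 'M[R]_N) :
  (0 < p)%E -> (p <= q)%E -> 0 <= a -> 0 <= t ->
  schatten_norm p A <= a -> opball t A ->
  schatten_norm q A <= a `^ (recip q / recip p) * t `^ (1 - recip q / recip p).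
Proof.
move=> p0 pq a0 t0 Aa At; have q0 : (0 < q)%E by apply: lt_le_trans pq.
have [qE|[s s0 qE]] := exponent_cases q0.
  rewrite qE recip_oo mul0r powRr0 subr0 powRr1 // mul1r schatten_oo.
  exact: opball_singval.
have [pE|[r r0 pE]] := exponent_cases p0; first by rewrite pE qE in pq.
rewrite qE pE !recip_fin invrK; rewrite pE qE lee_fin in pq.
rewrite schatten_fin_le ?mulr_ge0 ?powR_ge0 //.
rewrite powRM ?powR_ge0 // -!powRrM.
rewrite (_ : s^-1 * r * s = r); last by field; rewrite gt_eqF.
rewrite (_ : (1 - s^-1 * r) * s = s - r); last by field; rewrite gt_eqF.
rewrite pE (schatten_fin_le _ r0 a0) in Aa.
apply: le_trans (ler_wpM2r (powR_ge0 _ _) Aa); rewrite mulr_suml.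
apply: ler_sum => i _; rewrite -{1}(subrK r s) addrC powRD; last first.
  by rewrite addrC subrK gt_eqF.
rewrite ler_wpM2l ?powR_ge0 //.
apply: le_powR; rewrite ?subr_ge0 ?singval_ge0 //.
exact: opball_singval.
Qed.

Lemma schatten_embedding p q : (0 < q)%E -> (q <= p)%E ->
  exists2 C : R, 1 <= C & forall N (A : 'M[R]_N), (0 < N)%N ->
    schatten_norm p A <= 1 ->
    schatten_norm q A <= C * N%:R `^ (recip q - recip p).
Proof.
move=> q0 qp; have p0 : (0 < p)%E by apply: lt_le_trans qp.
have [qE|[s s0 qE]] := exponent_cases q0.
  have pE : p = +oo%E by move: qp; rewrite qE leye_eq => /eqP.
  exists 1 => // N A _; rewrite qE pE subrr powRr0 mulr1.
  by [].
have sV0 : 0 <= s^-1 by rewrite invr_ge0 ltW.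
have c1 : 1 <= 2 `^ s^-1 :> R by rewrite -[leLHS](powRr0 2) ler_powR ?ler1n.
exists (2 `^ s^-1) => // N A N0 A1; have N1 : 0 < N%:R :> R by rewrite ltr0n.
have [pE|[r r0 pE]] := exponent_cases p0.
  have A1' := schatten_opball p0 ler01 A1.
  apply: le_trans (schatten_le_rank q0 ler01 (leqnn N) A1' (rank_leq_row _)) _.
  by rewrite pE recip_oo subr0 mul1r ler_peMl ?powR_ge0.
rewrite qE pE !recip_fin schatten_fin_le ?mulr_ge0 ?powR_ge0 //.
rewrite pE (schatten_fin_le _ r0 ler01) one_powR in A1.
rewrite powRM ?powR_ge0 // -!powRrM mulVf ?gt_eqF // powRr1 //.
rewrite (_ : (s^-1 - r^-1) * s = 1 + - (r^-1 * s)); last first.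
  by field; rewrite !gt_eqF.
rewrite powRD; last by rewrite (gt_eqF N1) implybT.
rewrite powRr1 ?ler0n //.
(* [y^s <= 1 + y^r] for [y = N^(1/r) sigma_i] *)
pose w := N%:R `^ (- (r^-1 * s)).
have w0 : 0 <= w by exact: powR_ge0.
apply: (@le_trans _ _ (\sum_(i < N) w * (1 + N%:R * singval A i `^ r))).
  apply: ler_sum => i _; pose y := N%:R `^ r^-1 * singval A i.
  have y0 : 0 <= y by rewrite mulr_ge0 ?powR_ge0 ?singval_ge0.
  have -> : singval A i `^ s = w * y `^ s.
    rewrite powRM ?powR_ge0 ?singval_ge0 // -powRrM mulrA -powRD.
      by rewrite addNr powRr0 mul1r.
    by rewrite (gt_eqF N1) implybT.
  have -> : N%:R * singval A i `^ r = y `^ r.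
    rewrite powRM ?powR_ge0 ?singval_ge0 // -powRrM mulVf ?gt_eqF //.
    by rewrite powRr1 // ler0n.
  rewrite ler_wpM2l //; have [y1|/ltW y1] := leP y 1.
    rewrite ler_wpDr ?powR_ge0 // -[leRHS](one_powR s).
    exact: le_powR (ltW s0) y0 y1.
  rewrite ler_wpDl // ler_powR //.
  by rewrite qE pE lee_fin in qp.
rewrite -mulr_sumr big_split /= sumr_const card_ord -mulr_sumr.
rewrite mulrA mulrC ler_wpM2r //.
have := ler_wpM2l (ltW N1) A1; lra.
Qed.

End SchattenNorm.

(** * Coverings of Schatten balls by operator norm balls *)

(** The closed ball of radius [t] of the Schatten class. *)
Definition schatten_ball (R : realType) (N : nat) (p : \bar R) (t : R) :
    set 'M[R]_N :=
  [set A | schatten_norm p A <= t].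

Section SchattenCovers.
Variable R : realType.
Implicit Types (p q : \bar R) (r t : R) (N k l s : nat).

(** Nets of relative accuracy [2^(-s)]. *)
Lemma covers_opball_dyadic m n t s : 0 < t ->
  covers (@opball R m n t) (@opball R m n (t * 2 ^- s))
    (2 ^ ((3 + s) * (m * n))).
Proof.
move=> t0; have s0 : 0 < 2 ^- s :> R by rewrite invr_gt0 exprn_gt0.
have s1 : 2 ^- s <= 1 :> R.
  by rewrite invf_le1 ?exprn_gt0 // exprn_ege1 // ler1n.
have [M MB Mcov] := covers_opball_upper m n s0 s1.
rewrite -[X in opball X]mulr1; apply: covers_opballZ t0 _.
apply: covers_leq Mcov; rewrite -(ler_nat R) natrX exprM.
have e0 : 0 < (2 ^- s / 8 : R) ^+ (m * n) by rewrite exprn_gt0 // divr_gt0.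
rewrite -(ler_pM2r e0); apply: le_trans MB _.
rewrite -exprMn exprD (_ : 2 ^+ 3 = 8 :> R); last by ring.
rewrite (_ : _ * _ = 1) ?expr1n //; field.
by rewrite expf_neq0.
Qed.

Lemma covers_low_rank N k t s : 0 < t ->
  covers [set A | exists X : 'M[R]_(N, k), exists Y : 'M[R]_(k, N),
                    [/\ opball t X, opball 1 Y & A = X *m Y]]%classic
    (opball (3 * t * 2 ^- s)) (2 ^ (2 * (3 + s) * (N * k))).
Proof.
move=> t0; have s0 : 0 < 2 ^- s :> R by rewrite invr_gt0 exprn_gt0.
have s1 : 2 ^- s <= 1 :> R.
  by rewrite invf_le1 ?exprn_gt0 // exprn_ege1 // ler1n.
have [x xP] := covers_opball_dyadic N k s t0.
have [y yP] := covers_opball_dyadic k N s (@ltr01 R).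
have -> : (2 ^ (2 * (3 + s) * (N * k)) =
    #|{: 'I_(2 ^ ((3 + s) * (N * k))) * 'I_(2 ^ ((3 + s) * (k * N)))}|)%N.
  rewrite card_prod !card_ord -expnD (mulnC k).
  by rewrite addnn -mul2n -[in LHS]mulnA.
apply: (@covers_finType _ _ _ _ (fun i => x i.1 *m y i.2)).
move=> _ [X [Y [Xt Y1 ->]]].
have [i Xi] := xP X Xt; have [j Yj] := yP Y Y1; exists (i, j) => /=.
have ts0 : 0 <= t * 2 ^- s by rewrite mulr_ge0 ?ltW.
have -> : X *m Y - x i *m y j =
    (X - x i) *m Y + (X - (X - x i)) *m (Y - y j).
  by rewrite subKr mulmxBl mulmxBr addrA subrK.
apply: (@opball_le _ _ _ (t * 2 ^- s * 1 + (t + t * 2 ^- s) * (1 * 2 ^- s))).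
- by rewrite addr_ge0 ?mulr_ge0 ?addr_ge0 ?(ltW t0) ?(ltW s0).
- have : t * 2 ^- s * 2 ^- s <= t * 2 ^- s by rewrite ler_piMr.
  by rewrite !mul1r mulr1 mulrDl -(mulrA 3); lra.
apply: opballD.
- by rewrite mulr1.
- by rewrite mulr_ge0 ?addr_ge0 ?mulr_ge0 ?(ltW t0) ?(ltW s0).
- exact: opballM Xi Y1.
- by apply: opballM Yj; apply: opballB => //; rewrite ltW.
Qed.

Lemma powR_natX (x : R) l : (2 `^ x) ^+ l = (2 ^ l)%:R `^ x.
Proof.
by rewrite -powR_mulrn ?powR_ge0 // -powRrM mulrC powRrM powR_mulrn // natrX.
Qed.

(** The key estimate, by induction on [l] for finite [p]: with the centres in
    the Schatten ball, the differences between the points of a cell and its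
    centre have small operator norm and bounded Schatten norm, hence are well
    approximated by matrices of rank [O(2^l)], whose ball is covered with
    constant relative accuracy by [2^(O(N 2^l))] balls. *)
Lemma schatten_ball_covers p : (0 < p)%E -> exists2 b : nat, (0 < b)%N &
  forall N l, covers (schatten_ball p 1 : set 'M[R]_N)
    (opball ((2 `^ (- recip p)) ^+ l)) (2 ^ (b * N * 2 ^ l)).
Proof.
have accuracy (x e y : R) : 0 <= y -> 12 * e <= x ->
    x / 2 * y + 3 * (2 * y) * e <= x * y.
  by move=> y0 /(ler_wpM2r y0); lra.
move=> p0; have [pE|[r r0 pE]] := exponent_cases p0.
  exists 1%N => // N l; rewrite pE recip_oo oppr0 powRr0 expr1n.
  apply: (@covers_leq _ 1); first by rewrite expn_gt0.
  apply: (covers_sub (S := opball 1) (T := opball 1)) (covers1 _) => // A Ap.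
  by apply: (schatten_opball p0 ler01); rewrite pE; exact: Ap.
have [K K1 KP] := schatten_quasi_triangle p0.
have K0 : 0 < K by apply: lt_le_trans K1.
(* [m] makes the error of the approximation of rank [m 2^l], and [s] the error
   of the net of matrices of rank [m 2^l], at most half of the new radius. *)
pose th : R := 2 `^ (- recip p); have th0 : 0 < th by exact: powR_gt0.
pose m := (Num.truncn ((2 * K / th) `^ r)).+1.
have mP : K * m%:R `^ (- recip p) <= th / 2.
  have m0 : 0 < (m%:R : R) `^ r^-1 by rewrite powR_gt0 ?ltr0n.
  rewrite pE recip_fin powRN ler_pdivrMr //.
  have /truncn_itv/andP[_ /ltW] := powR_ge0 (2 * K / th) r.
  rewrite -/m => /(le_powR (r := r^-1)) H.
  have {H} : ((2 * K / th) `^ r) `^ r^-1 <= m%:R `^ r^-1.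
    by apply: H; rewrite ?powR_ge0 // invr_ge0 ltW.
  rewrite -powRrM mulfV ?gt_eqF // powRr1; last first.
    by rewrite divr_ge0 ?mulr_ge0 ?ltW.
  rewrite ler_pdivrMr // => H; rewrite mulrAC ler_pdivlMr //.
  by rewrite mulrC [th * _]mulrC.
pose s := (Num.truncn (12 / th)).+1.
have sP : 12 * 2 ^- s <= th.
  rewrite ler_pdivrMr ?exprn_gt0 // mulrC -ler_pdivrMr //.
  have /truncn_itv/andP[_ /ltW] : 0 <= 12 / th by rewrite divr_ge0 ?ltW.
  move=> /le_trans; apply; rewrite -/s -natrX ler_nat; exact/ltnW/ltn_expl.
exists (2 * (3 + s) * m)%N => [|N l]; first by rewrite !muln_gt0.
rewrite -/th; elim: l => [|l IH].
  apply: (@covers_leq _ 1); first by rewrite expn_gt0.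
  rewrite expr0.
  apply: (covers_sub (S := opball 1) (T := opball 1)) (covers1 _) => // A Ap.
  exact: schatten_opball p0 ler01 Ap.
pose rho := th ^+ l; have rho0 : 0 < rho by exact: exprn_gt0.
rewrite [(2 ^ l.+1)%N]expnS mulnCA mul2n -addnn expnD.
apply: (@covers_trans _
    [set A | schatten_norm p A <= K /\ opball (2 * rho) A]%classic).
  apply: covers_recenter IH => A B Ap Bp [C [AC BC]].
  split; first exact: KP Ap Bp.
  have -> : A - B = (A - C) - (B - C) by rewrite opprB addrA subrK.
  by rewrite mulr_natl mulr2n; apply: opballB; rewrite ?ltW.
have rho2 : 0 < 2 * rho by rewrite mulr_gt0.
have [y yP] := covers_low_rank N (m * 2 ^ l) s rho2.
rewrite (_ : _ * _ * N * _ = 2 * (3 + s) * (N * (m * 2 ^ l)))%N; last first.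
  by rewrite -!mulnA (mulnCA m N).
exists y => A [AK Arho].
have [X [Y [XP YP XY]]] := low_rank_approximation (m * 2 ^ l) A.
have [|j jP] := yP (X *m Y); first by exists X, Y; split => //; exact: XP.
exists j.
have -> : A - y j = (A - X *m Y) + (X *m Y - y j) by rewrite addrA subrK.
have s0 : 0 < 2 ^- s :> R by rewrite invr_gt0 exprn_gt0.
apply: (@opball_le _ _ _ (th / 2 * rho + 3 * (2 * rho) * 2 ^- s)).
- by rewrite addr_ge0 ?mulr_ge0 ?(ltW th0) ?(ltW rho0) ?(ltW s0).
- by rewrite exprS; exact: accuracy (ltW rho0) sP.
apply: opballD jP.
- by rewrite mulr_ge0 ?(ltW rho0) // divr_ge0 ?(ltW th0).
- by rewrite !mulr_ge0 ?(ltW rho0) ?(ltW s0).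
apply: opball_le XY; first exact: singval_ge0.
apply: le_trans (singval_le_schatten _ p0 (ltW K0) AK) _.
apply: le_trans (ler_wpM2r (ltW rho0) mP).
rewrite -mulrA ler_wpM2l ?(ltW K0) //.
rewrite /rho /th powR_natX -powRM ?ler0n // -natrM !powRN.
rewrite lef_pV2 ?posrE ?powR_gt0 ?ltr0n ?muln_gt0 ?expn_gt0 //.
by apply: le_powR; rewrite ?recip_ge0 ?ler0n // ler_nat leqnSn.
Qed.

End SchattenCovers.

(** * Entropy numbers of the embeddings *)

Section Entropy.
Variable R : realType.
Implicit Types (p q : \bar R) (eps t : R) (N k n : nat).

Lemma schatten_ballZ N p c t (A : 'M[R]_N) : (0 < p)%E -> 0 <= c ->
  schatten_norm p A <= t -> schatten_norm p (c *: A) <= c * t.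
Proof.
move=> p0 c0 At; apply: le_trans (schattenZ c A p0) _.
by rewrite ger0_norm // ler_wpM2l.
Qed.

(** By homogeneity of the quasi-norms, the coverings defining entropy numbers
    are coverings by translates of Schatten balls. *)
Lemma entropy_coverP N p q n eps : (0 < q)%E -> 0 < eps ->
  (exists y : 'I_(2 ^ n.-1) -> 'M[R]_N,
    ((idfun : {linear 'M[R]_N -> 'M[R]_N}) @`
        closed_unit_ball (@schatten_norm R N p) `<=`
      \bigcup_(j in [set: 'I_(2 ^ n.-1)])
        [set y j + eps *: b |
          b in closed_unit_ball (@schatten_norm R N q)])%classic)
  <-> covers (schatten_ball p 1 : set 'M[R]_N) (schatten_ball q eps) (2 ^ n.-1).
Proof.
move=> q0 e0; split=> -[y yP]; exists y.
  move=> A Ap; have [|j _ [B Bq <-]] := yP A; first by exists A.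
  exists j; rewrite addrC addKr.
  by have := schatten_ballZ q0 (ltW e0) Bq; rewrite mulr1.
move=> _ [A Ap <-]; have [j Aj] := yP A Ap; exists j => //.
exists (eps^-1 *: (A - y j)).
  have eV : 0 <= eps^-1 by rewrite invr_ge0 ltW.
  have := schatten_ballZ q0 eV Aj; rewrite mulVf ?gt_eqF //.
by rewrite scalerA mulfV ?gt_eqF // scale1r addrC subrK.
Qed.

Lemma schatten_entropy_le N p q n eps : (0 < q)%E -> 0 < eps ->
  covers (schatten_ball p 1 : set 'M[R]_N) (schatten_ball q eps) (2 ^ n.-1) ->
  schatten_entropy p q n N <= eps.
Proof.
move=> q0 e0 /(entropy_coverP N p n q0 e0) yP; apply: ge_inf; last by split.
by exists 0 => x [/ltW].
Qed.

Lemma le_schatten_entropy N p q n c : (0 < p)%E -> (0 < q)%E -> (0 < N)%N ->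
  (forall eps, 0 < eps ->
    covers (schatten_ball p 1 : set 'M[R]_N) (schatten_ball q eps) (2 ^ n.-1) ->
    c <= eps) ->
  c <= schatten_entropy p q n N.
Proof.
move=> p0 q0 N0 cP; apply: lb_le_inf; last first.
  by move=> eps [e0 /(entropy_coverP N p n q0 e0)]; exact: cP.
pose e : R := N%:R `^ recip q; have e0 : 0 < e by rewrite powR_gt0 ?ltr0n.
(* The set is nonempty: one ball of radius [N^(1/q)] covers. *)
exists e; split=> //; apply/entropy_coverP => //.
apply: (@covers_leq _ 1); first by rewrite expn_gt0.
exists (fun=> 0) => A Ap; exists ord0.
rewrite subr0 /schatten_ball /= -[e]mul1r.
apply: schatten_le_rank => //; last exact: rank_leq_row.
exact: schatten_opball p0 ler01 Ap.
Qed.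

(** The master lower bound: the matrices supported on the first [k] columns
    form a space of dimension [N k] with the operator norm, on which the norms
    of the Schatten classes are compared by [schatten_le_rank] and
    [schatten_ball_covers]. *)
Lemma schatten_cover_lower p q : (0 < p)%E -> (0 < q)%E ->
  exists2 c : R, 0 < c & forall N k n eps, (0 < k)%N -> (k <= N)%N -> 0 < eps ->
    covers (schatten_ball p 1 : set 'M[R]_N) (schatten_ball q eps) (2 ^ n.-1) ->
    c * 2 `^ (- (n%:R / (N * k)%:R)) * k%:R `^ (recip q - recip p) <= eps.
Proof.
move=> p0 q0; have [b b0 bP] := schatten_ball_covers q0.
exists (2 `^ (- (2 * b%:R))) => [|N k n eps k0 kN e0 epsP].
  exact: powR_gt0.
have N0 : (0 < N)%N by apply: leq_trans kN.
(* [k < 2 ^ l <= 2 k] *)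
pose l := (trunc_log 2 k).+1.
have /andP[lk kl] := trunc_log_bounds (isT : 1 < 2)%N k0.
set D := (N * k)%N; have D0 : (0 < D)%N by rewrite muln_gt0 N0.
pose th : R := (2 `^ (- recip q)) ^+ l.
have th0 : 0 < th by rewrite exprn_gt0 // powR_gt0.
have thk : th <= k%:R `^ (- recip q).
  rewrite /th powR_natX !powRN lef_pV2 ?posrE ?powR_gt0 ?ltr0n ?expn_gt0 //.
  by apply: le_powR; rewrite ?recip_ge0 ?ler0n // ler_nat ltnW.
pose ku : R := k%:R `^ recip p; have ku0 : 0 < ku by rewrite powR_gt0 ?ltr0n.
pose eps' := ku * eps * th.
have e'0 : 0 < eps' by rewrite !mulr_gt0.
have [y yP] : covers (schatten_ball p 1 : set 'M[R]_N) (opball (eps * th))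
    (2 ^ n.-1 * 2 ^ (b * N * 2 ^ l)).
  apply: covers_trans epsP _; have [z zP] := bP N l.
  exists (fun j => eps *: z j) => A Aq.
  have [|j Aj] := zP (eps^-1 *: A).
    have eV : 0 <= eps^-1 by rewrite invr_ge0 ltW.
    by have := schatten_ballZ q0 eV Aq; rewrite mulVf ?gt_eqF.
  exists j; have := opballZ eps Aj.
  by rewrite gtr0_norm // scalerBr scalerA mulfV ?gt_eqF // scale1r.
have VP : covers (@opball R N k 1) (opball eps')
    (2 ^ n.-1 * 2 ^ (b * N * 2 ^ l)).
  exists (fun j => ku *: (y j *m (pid_mx k : 'M[R]_(N, k)))) => X X1.
  pose X' : 'M[R]_N := X *m (pid_mx k : 'M[R]_(k, N)).
  have X'1 : opball 1 X'.
    by rewrite -[1]mulr1; apply: opballM => //; exact: opball_pid_mx.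
  have X'k : (\rank X' <= k)%N.
    exact: leq_trans (mxrankM_maxl _ _) (rank_leq_col _).
  have [|j Xj] := yP (ku^-1 *: X').
    have := schatten_le_rank p0 ler01 kN X'1 X'k; rewrite mul1r => Xp.
    have kV : 0 <= ku^-1 by rewrite invr_ge0 ltW.
    by have := schatten_ballZ p0 kV Xp; rewrite mulVf ?gt_eqF.
  exists j; have -> : X - ku *: (y j *m (pid_mx k : 'M[R]_(N, k))) =
      (ku *: (ku^-1 *: X' - y j)) *m (pid_mx k : 'M[R]_(N, k)).
    rewrite scalerBr scalerA mulfV ?gt_eqF // scale1r mulmxBl /X' -mulmxA.
    rewrite pid_mx_id // -[pid_mx k : 'M[R]_k]/(pid_mx k) pid_mx_1 mulmx1.
    by rewrite scalemxAl.
  rewrite -[eps']mulr1 /eps' -[ku * eps * th]mulrA.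
  apply: opballM; last exact: opball_pid_mx.
  by rewrite -[ku in opball (ku * _)]gtr0_norm //; exact: opballZ.
have := covers_opball_lower e'0 VP; rewrite -/D -expnD natrX => H.
have {H} H : 1 <= (2 `^ (n%:R / D%:R + 2 * b%:R) * eps') ^+ D.
  apply: le_trans H _; rewrite [leRHS]exprMn ler_wpM2r ?exprn_ge0 ?(ltW e'0) //.
  rewrite -[leRHS]powR_mulrn ?powR_ge0 // -powRrM mulrDl mulfVK; last first.
    by rewrite pnatr_eq0 -lt0n.
  rewrite -powR_mulrn // ler_powR ?ler1n // -!natrM -natrD ler_nat.
  apply: leq_add; first exact: leq_pred.
  rewrite /D /l expnS.
  move: lk; set w := (2 ^ _)%N => lk.
  have := leq_mul (leqnn (2 * (b * N))) lk; lia.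
have {}H : 1 <= 2 `^ (n%:R / D%:R + 2 * b%:R) * eps'.
  rewrite leNgt; apply/negP => lt1; move: H; rewrite leNgt => /negP[].
  rewrite exprn_ilt1 //; first by rewrite -lt0n.
  exact: mulr_ge0 (powR_ge0 _ _) (ltW e'0).
have {}H : 2 `^ (- (n%:R / D%:R)) * 2 `^ (- (2 * b%:R)) <= eps'.
  rewrite -powRD ?pnatr_eq0 ?implybT // -opprD powRN.
  by rewrite -[leLHS]mul1r ler_pdivrMr ?powR_gt0 // mulrC.
have k0' : k%:R != 0 :> R by rewrite pnatr_eq0 -lt0n.
have -> : k%:R `^ (recip q - recip p) = (ku * k%:R `^ (- recip q))^-1.
  by rewrite -powRD ?k0' ?implybT // -powRN opprB.
rewrite ler_pdivrMr; last by rewrite mulr_gt0 ?powR_gt0 ?ltr0n.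
rewrite mulrC; apply: le_trans H _; rewrite /eps' mulrAC [leRHS]mulrC.
by rewrite ler_pM2r // ler_pM2l.
Qed.

End Entropy.

Section EntropyUpper.
Variable R : realType.
Implicit Types (p q : \bar R) (N n : nat).

Lemma schatten_entropy_le1 p q N n : (0 < p)%E -> (p <= q)%E ->
  @schatten_entropy R p q n N <= 1.
Proof.
move=> p0 pq; have q0 : (0 < q)%E by apply: lt_le_trans pq.
apply: schatten_entropy_le => //.
apply: (@covers_leq _ 1); first by rewrite expn_gt0.
exists (fun=> 0) => A Ap; exists ord0; rewrite subr0 /schatten_ball /=.
have A1 := schatten_opball p0 ler01 Ap.
have := schatten_interpolation p0 pq ler01 ler01 Ap A1.
by rewrite !one_powR mulr1.
Qed.

Lemma schatten_entropy_le_embedding p q : (0 < q)%E -> (q <= p)%E ->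
  exists2 C : R, 1 <= C & forall N n, (0 < N)%N ->
    schatten_entropy p q n N <= C * N%:R `^ (recip q - recip p).
Proof.
move=> q0 qp; have [C C1 CP] := schatten_embedding q0 qp.
have C0 : 0 < C by apply: lt_le_trans C1.
exists C => // N n N0; apply: schatten_entropy_le => //.
  by rewrite mulr_gt0 ?powR_gt0 ?ltr0n.
apply: (@covers_leq _ 1); first by rewrite expn_gt0.
by exists (fun=> 0) => A Ap; exists ord0; rewrite subr0; exact: CP.
Qed.

(** The covering of the Schatten ball by operator norm balls, followed by
    interpolation between the exponents [p] and [+oo].  The bound holds for all
    [n >= 1]. *)
Lemma schatten_entropy_le_medium p q : (0 < p)%E -> (p <= q)%E ->
  exists2 C : R, 0 < C & forall N n, (0 < n)%N -> (0 < N)%N ->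
    schatten_entropy p q n N <= C * (N%:R / n%:R) `^ (recip p - recip q).
Proof.
move=> p0 pq; have q0 : (0 < q)%E by apply: lt_le_trans pq.
have [b b0 bP] := schatten_ball_covers p0.
have [K K1 KP] := schatten_quasi_triangle p0.
have K0 : 0 < K by apply: lt_le_trans K1.
have u0 := recip_ge0 p0; have v0 := recip_ge0 q0; have vu := recip_le p0 pq.
pose w := recip q / recip p; have w0 : 0 <= w by rewrite divr_ge0.
have w1 : 0 <= 1 - w.
  have [uE|un0] := eqVneq (recip p) 0; first by rewrite /w uE invr0 mulr0 subr0.
  by rewrite subr_ge0 ler_pdivrMr ?mul1r // lt_def un0.
have uw : recip p * (1 - w) = recip p - recip q.
  have [uE|un0] := eqVneq (recip p) 0.
    have -> : recip q = 0 by apply/eqP; rewrite eq_le v0 -uE vu.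
    by rewrite uE mul0r subrr.
  by rewrite /w mulrBr mulr1 mulrCA mulfV ?mulr1.
pose C1 := K `^ w * 2 `^ (1 - w).
have C1p : 0 < C1 by rewrite mulr_gt0 ?powR_gt0.
have C11 : 1 <= C1.
  rewrite -[leLHS]mulr1; apply: ler_pM => //.
    by rewrite -[leLHS](powRr0 K) ler_powR.
  by rewrite -[leLHS](powRr0 2) ler_powR ?ler1n.
have uv0 : 0 <= recip p - recip q by rewrite subr_ge0.
have b0' : 0 < (2 * b)%:R :> R by rewrite ltr0n muln_gt0.
exists (C1 * (2 * b)%:R `^ (recip p - recip q)) => [|N n n0 N0].
  by rewrite mulr_gt0 ?powR_gt0.
have n0' : 0 < n%:R :> R by rewrite ltr0n.
have Nn : 0 <= N%:R / n%:R :> R by rewrite divr_ge0.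
rewrite -mulrA -powRM //.
have bN0 : (0 < b * N)%N by rewrite muln_gt0 b0.
(* Use the largest [l] with [b N 2^l <= n - 1]; there is none when [m = 0],
   and then [N / n] is bounded below. *)
pose m := (n.-1 %/ (b * N))%N.
have [m0|m0] := posnP m.
  apply: le_trans (schatten_entropy_le1 _ _ p0 pq) _.
  rewrite -[leLHS]mulr1; apply: ler_pM => //.
  rewrite -[leLHS](one_powR (recip p - recip q)); apply: le_powR => //.
  rewrite mulrA ler_pdivlMr // mul1r -natrM ler_nat.
  have := ltn_ceil n.-1 bN0; rewrite -/m m0 mul1n (prednK n0).
  by move=> /leq_trans; apply; rewrite -mulnA leq_pmull.
pose l := trunc_log 2 m.
have /andP[lm ml] := trunc_log_bounds (isT : 1 < 2)%N m0.
have lP : (b * N * 2 ^ l <= n.-1)%N.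
  by apply: leq_trans (leq_divM n.-1 (b * N)); rewrite mulnC leq_mul2r lm orbT.
have Pl : (n <= 2 * b * N * 2 ^ l)%N.
  rewrite -[n in (n <= _)%N](prednK n0).
  apply: leq_trans (ltn_ceil n.-1 bN0) _; rewrite -/m.
  apply: leq_trans (leq_mul ml (leqnn _)) _.
  by rewrite expnS -/l mulnAC mulnA.
pose rho : R := (2 `^ (- recip p)) ^+ l.
have rho0 : 0 < rho by rewrite exprn_gt0 // powR_gt0.
apply: (@le_trans _ _ (K `^ w * (2 * rho) `^ (1 - w))).
  apply: schatten_entropy_le => //.
    by rewrite mulr_gt0 ?powR_gt0 ?mulr_gt0.
  apply: (@covers_leq _ (2 ^ (b * N * 2 ^ l))); first by rewrite leq_exp2l.
  apply: covers_recenter (bP N l) => A B Ap Bp [D [AD BD]].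
  have rho2 : 0 <= 2 * rho by rewrite mulr_ge0 // ltW.
  apply: (schatten_interpolation p0 pq (ltW K0) rho2 (KP _ _ _ Ap Bp)).
  have -> : A - B = (A - D) - (B - D) by rewrite opprB addrA subrK.
  by rewrite mulr_natl mulr2n; apply: opballB; rewrite ?ltW.
have l0 : 0 < (2 ^ l)%:R :> R by rewrite ltr0n expn_gt0.
rewrite powRM ?(ltW rho0) // mulrA ler_pM2l // /rho powR_natX -powRrM mulNr uw.
rewrite -mulN1r powRrM powR_inv1 ?(ltW l0) //; apply: le_powR => //.
rewrite -[leLHS]mul1r ler_pdivrMr // mulrA mulrAC ler_pdivlMr // mul1r.
by rewrite -!natrM ler_nat mulnAC in Pl *.
Qed.

(** The factor [2 `^ (2 * b).+1%:R] in the constant pays for the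
    [2^(b N 2^l) <= 2^(2 b N^2)] balls of the first covering and for the [n - 1]
    in the definition of the entropy numbers. *)
Lemma schatten_entropy_le_large p q : (0 < p)%E -> (0 < q)%E ->
  exists2 a : R, 0 < a & forall N n, (0 < n)%N -> (0 < N)%N ->
    a * 2 `^ (- (n%:R / (N ^ 2)%:R)) <= 1 ->
    schatten_entropy p q n N <=
      a * 2 `^ (- (n%:R / (N ^ 2)%:R)) * N%:R `^ (recip q - recip p).
Proof.
move=> p0 q0; have [b b0 bP] := schatten_ball_covers p0.
exists (8 * 2 `^ (2 * b).+1%:R) => [|N n n0 N0].
  by rewrite mulr_gt0 ?powR_gt0.
set D := (N ^ 2)%N; have D0 : (0 < D)%N by rewrite expn_gt0 N0.
set eps := _ * _ * 2 `^ _ => eps1.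
have eps0 : 0 < eps by rewrite !mulr_gt0 ?powR_gt0.
have [M MB Mcov] := covers_opball_upper N N eps0 eps1.
(* [N < 2 ^ l <= 2 N] *)
pose l := (trunc_log 2 N).+1.
have /andP[lN Nl] := trunc_log_bounds (isT : 1 < 2)%N N0.
pose nu : R := N%:R `^ (- recip p).
have nu0 : 0 < nu by rewrite powR_gt0 ?ltr0n.
have rho_nu : (2 `^ (- recip p)) ^+ l <= nu.
  rewrite /nu powR_natX !powRN lef_pV2 ?posrE ?powR_gt0 ?ltr0n ?expn_gt0 //.
  by apply: le_powR; rewrite ?recip_ge0 ?ler0n // ler_nat ltnW.
apply: schatten_entropy_le => //.
  by rewrite mulr_gt0 ?powR_gt0 ?ltr0n.
apply: (@covers_leq _ (2 ^ (b * N * 2 ^ l) * M)).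
  have MD : (M * 2 ^ ((2 * b).+1 * D) <= 2 ^ n)%N.
    have D0' : D%:R != 0 :> R by rewrite pnatr_eq0 -lt0n.
    have E : (eps / 8) ^+ (N * N) = (2 ^ ((2 * b).+1 * D))%:R / (2 ^ n)%:R.
      rewrite (_ : eps / 8 = 2 `^ ((2 * b).+1%:R - n%:R / D%:R)); last first.
        rewrite powRD ?pnatr_eq0 ?implybT // /eps mulrAC (mulrAC 8).
        by rewrite mulfV ?mul1r // pnatr_eq0.
      rewrite mulnn -/D -powR_mulrn ?powR_ge0 // -powRrM mulrBl mulfVK //.
      rewrite powRB ?pnatr_eq0 ?implybT // -natrM !powR_mulrn //.
      by rewrite !natrX.
    move: MB; rewrite E mulrA ler_pdivrMr ?ltr0n ?expn_gt0 // mul1r.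
    by rewrite -natrM ler_nat.
  have lb : (b * N * 2 ^ l <= 2 * b * D)%N.
    rewrite /l expnS /D expnS expn1 mulnCA -!mulnA leq_mul2l /=.
    by rewrite !leq_mul2l lN !orbT.
  rewrite -(leq_pmul2l (isT : 0 < 2)%N) -expnS prednK //.
  apply: leq_trans MD; rewrite mulnA -expnS mulnC leq_mul2l leq_exp2l // mulSn.
  by rewrite (leq_add D0 lb) orbT.
apply: (covers_trans (T := opball nu)).
  apply: (covers_sub (S := schatten_ball p 1)
    (T := opball ((2 `^ (- recip p)) ^+ l))) (bP N l) => // A.
  by apply: opball_le => //; rewrite exprn_ge0 ?powR_ge0.
have nuV := covers_opballZ nu0 Mcov; rewrite mulr1 in nuV.
apply: (covers_sub (S := opball nu) (T := opball (nu * eps))) nuV => // A Ae.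
rewrite /schatten_ball /=.
have ne0 : 0 <= nu * eps by rewrite mulr_ge0 ?ltW.
apply: le_trans (schatten_le_rank q0 ne0 (leqnn N) Ae (rank_leq_row _)) _.
rewrite [nu * _]mulrC -mulrA ler_pM2l // /nu -powRD 1?addrC //.
by rewrite pnatr_eq0 -lt0n N0 implybT.
Qed.

End EntropyUpper.

Theorem theorem1p1 (R : realType) (p q : \bar R) (hp : (0 < p)%E)
    (hq : (0 < q)%E) :
  exists c C : R, [/\ 0 < c, 0 < C &
    forall n N : nat, (1 <= n)%N -> (1 <= N)%N ->
    forall v : R, Phi p q n N v ->
      c * v <= schatten_entropy p q n N <= C * v].
Proof.
have [c c0 cP] := schatten_cover_lower hp hq.
have lower N k n : (0 < k)%N -> (k <= N)%N ->
    c * 2 `^ (- (n%:R / (N * k)%:R)) * k%:R `^ (recip q - recip p) <=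
      schatten_entropy p q n N.
  move=> k0 kN; apply: le_schatten_entropy => //; first exact: leq_trans kN.
  by move=> eps; exact: cP.
have [C1 C10 C1P] : exists2 C1 : R, 0 < C1 & (q <= p)%E -> forall N n,
    (0 < N)%N -> schatten_entropy p q n N <= C1 * N%:R `^ (recip q - recip p).
  have [qp|_] := boolP (q <= p)%E; last by exists 1.
  have [C C1 CP] := schatten_entropy_le_embedding hq qp.
  by exists C; first exact: lt_le_trans C1.
have [C2 C20 C2P] : exists2 C2 : R, 0 < C2 & (p <= q)%E -> forall N n,
    (0 < n)%N -> (0 < N)%N ->
    schatten_entropy p q n N <= C2 * (N%:R / n%:R) `^ (recip p - recip q).
  have [pq|_] := boolP (p <= q)%E; last by exists 1.
  by have [C C0 CP] := schatten_entropy_le_medium hp pq; exists C.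
have [a a0 aP] := schatten_entropy_le_large hp hq.
pose C := 1 + C2 + a + C1 * a + C2 * a.
have C1a : 0 < C1 * a by rewrite mulr_gt0.
have C2a : 0 < C2 * a by rewrite mulr_gt0.
have [CC1 CC2 CCa CC1a CC2a] :
    [/\ 1 <= C, C2 <= C, a <= C, C1 * a <= C & C2 * a <= C].
  by rewrite /C; split; lra.
have C0 : 0 < C by exact: lt_le_trans CC1.
exists (c / 4), C; split=> //; first by rewrite divr_gt0.
have c4 : c / 4 <= c by lra.
move=> n N n0 N0 v.
have N0' : 0 < N%:R :> R by rewrite ltr0n.
have n0' : 0 < n%:R :> R by rewrite ltr0n.
pose tau : R := 2 `^ (- (n%:R / (N ^ 2)%:R)).
have tau0 : 0 < tau by exact: powR_gt0.
pose f : R := N%:R `^ (recip q - recip p).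
have f0 : 0 < f by exact: powR_gt0.
have lower_large : c / 4 * (tau * f) <= schatten_entropy p q n N.
  apply: le_trans (lower N N n N0 (leqnn N)).
  rewrite -/f mulnn -/tau -[leRHS]mulrA.
  by rewrite ler_wpM2r // mulr_ge0 ?ltW.
have upper_large : a * tau <= 1 -> schatten_entropy p q n N <= C * (tau * f).
  move=> at1; apply: le_trans (aP N n n0 N0 at1) _; rewrite -/tau -/f -mulrA.
  by rewrite ler_wpM2r // mulr_ge0 ?ltW.
have quarter (x : R) : x <= 2 -> 4^-1 <= 2 `^ (- x) :> R.
  move=> x2; rewrite powRN lef_pV2 ?posrE ?powR_gt0 //.
  have -> : 4 = 2 `^ 2 :> R by rewrite powR_mulrn // expr2 -natrM.
  by rewrite ler_powR // ler1n.
have invE (x y : R) : 0 < x -> x `^ (- y) = x^-1 `^ y.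
  by move=> x0; rewrite -mulN1r powRrM powR_inv1 // ltW.
case=> [qp|pq /andP[_ nN]|pq /andP[Nn nN]|pq Nn].
- rewrite lower_large /=.
  (* When [tau] is bounded below, the norm of the embedding is good enough. *)
  have [|/ltW at1] := leP (a * tau) 1; first exact: upper_large.
  apply: le_trans (C1P qp N n N0) _; rewrite -/tau -/f mulrA ler_pM2r //.
  rewrite -[leLHS]mulr1; apply: le_trans (ler_wpM2l (ltW C10) at1) _.
  by rewrite mulrA ler_pM2r.
- apply/andP; split; last first.
    apply: le_trans (schatten_entropy_le1 _ _ hp pq) _.
    by rewrite mulr1.
  apply: le_trans (lower N 1%N n isT N0); rewrite one_powR !mulr1 muln1.
  rewrite ler_pM2l //; apply: quarter; rewrite ler_pdivrMr // -natrM ler_nat.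
  by apply: leq_trans nN _; rewrite leq_pmull.
- apply/andP; split; last first.
    by apply: le_trans (C2P pq N n n0 N0) _; rewrite ler_wpM2r ?powR_ge0.
  pose k := (n %/ N)%N; have k0 : (0 < k)%N by rewrite divn_gt0.
  have kN : (k <= N)%N by rewrite -(mulnK N N0) mulnn leq_div2r.
  have k0' : 0 < k%:R :> R by rewrite ltr0n.
  apply: le_trans (lower N k n k0 kN); apply: ler_pM.
  + by rewrite ltW // divr_gt0.
  + exact: powR_ge0.
  + rewrite ler_pM2l //; apply: quarter; rewrite ler_pdivrMr; last first.
      by rewrite ltr0n muln_gt0 N0.
    rewrite -natrM ler_nat; apply: ltnW; apply: leq_trans (ltn_ceil n N0) _.
    by rewrite mulnCA mulnC leq_mul2l -/k mul2n -addnn -addn1 leq_add2l k0 orbT.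
  + rewrite -[recip q - _]opprB invE //; apply: le_powR.
    * by rewrite subr_ge0 recip_le.
    * by rewrite divr_ge0.
    rewrite ler_pdivrMr // mulrC ler_pdivlMr // -natrM ler_nat.
    by rewrite mulnC leq_divM.
- rewrite lower_large /=.
  (* When [tau] is bounded below, the bound of the intermediate range at [n]
     is good enough. *)
  have [|/ltW at1] := leP (a * tau) 1; first exact: upper_large.
  apply: le_trans (C2P pq N n n0 N0) _; rewrite -/tau -/f.
  have Nf : (N%:R / n%:R) `^ (recip p - recip q) <= f.
    rewrite /f -[recip q - _]opprB invE //; apply: le_powR.
    + by rewrite subr_ge0 recip_le.
    + by rewrite divr_ge0.
    by rewrite ler_pdivrMr // mulrC ler_pdivlMr // -natrM ler_nat mulnn.
  apply: le_trans (ler_wpM2l (ltW C20) Nf) _; rewrite mulrA ler_pM2r //.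
  rewrite -[leLHS]mulr1; apply: le_trans (ler_wpM2l (ltW C20) at1) _.
  by rewrite mulrA ler_pM2r.
Qed.
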